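(* Let $D$ be an integral domain, and let $\boldsymbol{F}(D)$ be the set of nonzero fractional ideals of $D$. The following are equivalent. (i) $v=v_a$ on $\boldsymbol{F}(D)$. (ii) $D$ is a P$v$MD and $v=t$ on $\boldsymbol{F}(D)$. (iii) $D$ is a $v$-domain and $v=t$ on $\boldsymbol{F}(D)$. (iv) $D$ is an essential domain and $v=t$ on $\boldsymbol{F}(D)$. (v) $D$ is integrally closed and $\mathrm{Na}(D,v)$ is a divisorial domain. (vi) $D$ is integrally closed and $v=w$ on $\boldsymbol{F}(D)$. (vii) $\mathrm{Na}(D,v)=\mathrm{Kr}(D,v)$ is h-local and its maximal ideals are finitely generated. (viii) $w=v_a$ (on $\boldsymbol{F}(D)$) and $v=t$ on $\boldsymbol{F}(D)$. (ix) $v=w_a$ on $\boldsymbol{F}(D)$. (x) $w=t=v=w_a=t_a=v_a$ on $\boldsymbol{F}(D)$.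
   Context: Let $D$ be an integral domain with quotient field $K$; $\overline{\boldsymbol{F}}(D)$ denotes the set of nonzero $D$-submodules of $K$, $\boldsymbol{F}(D)$ the nonzero fractional ideals, $\boldsymbol{f}(D)$ the nonzero finitely generated fractional ideals. For $D$-submodules $A,B$ of $K$, $(A:B):=\{x\in K\mid xB\subseteq A\}$; $E^{-1}:=(D:E)$. A semistar operation on $D$ is a map $\star:\overline{\boldsymbol F}(D)\to\overline{\boldsymbol F}(D)$ such that for $0\ne z\in K$ and $E,F\in\overline{\boldsymbol F}(D)$: $(zE)^\star=zE^\star$; $E\subseteq F\Rightarrow E^\star\subseteq F^\star$; $E\subseteq E^\star=(E^\star)^\star$. For $E\in\overline{\boldsymbol F}(D)$: $E^v:=(D:(D:E))$; $E^t:=\bigcup\{F^v\mid F\in\boldsymbol f(D), F\subseteq E\}$; $E^w:=\bigcap\{ED_Q\mid Q\in\mathrm{Max}^t(D)\}$ (an empty intersection being $K$), where $\mathrm{Max}^t(D)$ is the set of maximal elements among proper nonzero ideals $I$ of $D$ with $I^t=I$. For a semistar operation $\star$ on $D$, $\star_a$ is the semistar operation given by $F^{\star_a}:=\bigcup\{((FH)^\star:H^\star)\mid H\in\boldsymbol f(D)\}$ for $F\in\boldsymbol f(D)$ and $E^{\star_a}:=\bigcup\{F^{\star_a}\mid F\in\boldsymbol f(D),F\subseteq E\}$ for $E\in\overline{\boldsymbol F}(D)$. Let $X$ be an indeterminate and $\boldsymbol c(h)$ the content ideal of $h\in D[X]$ (the ideal generated by its coefficients). $\mathrm{Na}(D,v):=\{f/g\in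 K(X)\mid f,g\in D[X], g\ne0, \boldsymbol c(g)^v=D\}$. $\mathrm{Kr}(D,v):=\{f/g\mid f,g\in D[X], g\neq 0,\text{ and there is } h\in D[X]\setminus\{0\}\text{ with }\boldsymbol c(f)\boldsymbol c(h)\subseteq(\boldsymbol c(g)\boldsymbol c(h))^v\}$. $D$ is a $v$-domain if $(FF^{-1})^v=D$ for all $F\in\boldsymbol f(D)$ (equivalently, $v$ is e.a.b.), and a P$v$MD if $(FF^{-1})^t=D$ for all $F\in\boldsymbol f(D)$. $D$ is essential if it is an intersection of localizations $D_P$ ($P$ prime) that are valuation domains. A domain is divisorial if every nonzero ideal $I$ satisfies $I^v=I$ (with $v$ computed in that domain). A domain is h-local if each nonzero ideal is contained in at most finitely many maximal ideals and each nonzero prime ideal is contained in a unique maximal ideal. *)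

(* Defs.v *)
From HB Require Import structures.
From mathcomp Require Import all_boot all_order all_algebra.
From mathcomp Require Import all_classical.
Set Implicit Arguments.
Unset Strict Implicit.
Unset Printing Implicit Defensive.
Import GRing.Theory.
Local Open Scope classical_set_scope.
Local Open Scope ring_scope.

(* Ideal theory of a subring A of a field L, where L plays the role of the
   quotient field of A.  Working with subsets of a fixed field lets the same
   definitions apply to D inside K and to Na(D,v) inside K(X).  None of the
   definitions assumes that A is a subring with quotient field L; both have to
   hold where they are used. *)
Section IdealTheory.
Variables (L : fieldType) (A : set L).
Implicit Types E F H I J M P Q : set L.

Definition submodule E : Prop :=
  E 0 /\ forall a x y, A a -> E x -> E y -> E (a * x + y).

Definition nonzero E : Prop := exists2 x, E x & x != 0.

(* The A-submodule of L generated by G. *)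
Definition span (G : set L) : set L := smallest submodule G.

Definition mprod E F : set L := span [set x * y | x in E & y in F].

(* (E : F), computed in L *)
Definition colon E F : set L := [set x | forall y, F y -> E (x * y)].

Definition fin_gen E : Prop := exists s : seq L, E = span [set` s].

Definition frac_ideal E : Prop :=
  [/\ submodule E, nonzero E &
      exists d, [/\ A d, d != 0 & forall x, E x -> A (d * x)]].

Definition fg_frac_ideal E : Prop := frac_ideal E /\ fin_gen E.

(* The zero ideal and A itself are ideals. *)
Definition ideal I : Prop := submodule I /\ I `<=` A.

Definition proper_ideal I : Prop := ideal I /\ I <> A.

Definition prime_ideal P : Prop :=
  proper_ideal P /\
  forall x y, A x -> A y -> P (x * y) -> P x \/ P y.

Definition maximal_ideal M : Prop :=
  proper_ideal M /\ forall J, proper_ideal J -> M `<=` J -> J = M.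

Definition localization P : set L :=
  [set x | exists a s, [/\ A a, A s, ~ P s & x = a / s]].

Definition op_v E : set L := colon A (colon A E).

Definition op_t E : set L :=
  \bigcup_(F in [set F | fg_frac_ideal F /\ F `<=` E]) op_v F.

Definition proper_t_ideal I : Prop :=
  [/\ proper_ideal I, nonzero I & op_t I = I].

Definition t_maximal Q : Prop :=
  proper_t_ideal Q /\ forall J, proper_t_ideal J -> Q `<=` J -> J = Q.

(* When there is no t-maximal ideal (A a field) the intersection is all of L. *)
Definition op_w E : set L :=
  \bigcap_(Q in t_maximal) mprod E (localization Q).

Section AssociatedOperation.
Variable star : set L -> set L.

(* Only meant for finitely generated F. *)
Definition op_a_fg F : set L :=
  \bigcup_(H in fg_frac_ideal) colon (star (mprod F H)) (star H).

Definition op_a E : set L :=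
  \bigcup_(F in [set F | fg_frac_ideal F /\ F `<=` E]) op_a_fg F.

End AssociatedOperation.

Definition eq_on_F (star1 star2 : set L -> set L) : Prop :=
  forall E, frac_ideal E -> star1 E = star2 E.

Definition v_domain : Prop :=
  forall F, fg_frac_ideal F -> op_v (mprod F (colon A F)) = A.

Definition PvMD : Prop :=
  forall F, fg_frac_ideal F -> op_t (mprod F (colon A F)) = A.

Definition divisorial_domain : Prop :=
  forall I, ideal I -> nonzero I -> op_v I = I.

Definition h_local : Prop :=
  (forall I, ideal I -> nonzero I ->
     finite_set [set M | maximal_ideal M /\ I `<=` M]) /\
  (forall P, prime_ideal P -> nonzero P ->
     exists! M, maximal_ideal M /\ P `<=` M).

End IdealTheory.

(* A subring V of L is a valuation domain with quotient field L. *)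
Definition valuation_domain (L : fieldType) (V : set L) : Prop :=
  forall x : L, x != 0 -> V x \/ V x^-1.

Definition essential_domain (L : fieldType) (A : set L) : Prop :=
  exists S : set (set L),
    (forall P, S P -> prime_ideal A P /\ valuation_domain (localization A P)) /\
    A = \bigcap_(P in S) localization A P.

Section Domain.
Variable D : idomainType.
Local Notation K := {fraction D}.
Local Notation KX := {fraction {poly K}}.

(* D as a subring of its quotient field K *)
Definition dom : set K := range (@tofrac D).

Definition integrally_closed : Prop :=
  forall x : K, integralOver (@tofrac D) x -> dom x.

Definition content (h : {poly D}) : set K :=
  span dom [set tofrac c | c in [set` (h : seq D)]].

Definition polyfrac (f g : {poly D}) : KX :=
  tofrac (map_poly (@tofrac D) f) / tofrac (map_poly (@tofrac D) g).

Definition Na_v : set KX :=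
  [set z | exists f g : {poly D},
     [/\ g != 0, op_v dom (content g) = dom & z = polyfrac f g]].

Definition Kr_v : set KX :=
  [set z | exists f g : {poly D},
     [/\ g != 0,
         exists2 h : {poly D}, h != 0 &
           mprod dom (content f) (content h) `<=`
           op_v dom (mprod dom (content g) (content h))
       & z = polyfrac f g]].

End Domain.

Arguments dom D : clear implicits.
Arguments integrally_closed D : clear implicits.
Arguments Na_v D : clear implicits.
Arguments Kr_v D : clear implicits.

(* Main.v *)
From HB Require Import structures.
From mathcomp Require Import all_boot all_order all_algebra.
From mathcomp Require Import all_classical.
From mathcomp Require Import ring.
Require Import Defs.
Set Implicit Arguments.
Unset Strict Implicit.
Unset Printing Implicit Defensive.
Import GRing.Theory.
Local Open Scope classical_set_scope.
Local Open Scope ring_scope.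

(** Write vprim for the set of nonzero polynomials g over A = D whose content
    c(g) has trivial dual, that is, c(g)^v = A.  Three facts about them carry the
    proof.

    The set vprim absorbs integrality: if g is in vprim and fg has coefficients
    in A, then so has f (vprim_gauss).  So vprim is multiplicative, and
    N = Na(D,v) is the localization of A[X] at vprim, with N and K[X] meeting in
    A[X].  Secondly, E^w consists of the x with c(g)x contained in E for some g
    in vprim (op_wP); after this, the maximal t-ideals are only needed for
    essential domains.  Thirdly, A is a PvMD if and only if every nonzero g has
    a multiple yg in vprim with the coefficients of y in the dual of c(g)
    (PvMD_inverse, inverse_PvMD).

    All conditions are compared with the pair: A is a v-domain and v = t.  Being
    a v-domain means that xF contained in F^v forces x in A, for F finitely
    generated (v_domainP).  In this form it follows from v = v_a, from v = w_a,
    from essentiality, and, if A is integrally closed, from v = w: a g in vprim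
    carries x to elements t with tF contained in F, which are integral over A by
    the Cayley-Hamilton argument.  Conversely v = t makes a v-domain a PvMD, and
    over a PvMD the third fact gives w = t, hence the equality of all
    the operations and of their associated operations.

    For the function rings, over a PvMD each polynomial f generates in N the same
    ideal as its coefficients.  So N is a Bezout domain equal to Kr(D,v), and
    every ideal of N is extended from its trace on A, so that v = w on A makes
    N divisorial (nagata_divisorial).  Conversely, if N is divisorial, then
    I^v is contained in the trace of IN, which is I^w
    (nagata_divisorial_v_sub_w).  If N = Kr(D,v), then a/g is in N for every
    coefficient a of g, and a common denominator of these fractions is the
    multiple yg required for a PvMD (kronecker_PvMD).

    It remains to see that a Bezout domain is divisorial if and only if it is
    h-local with finitely generated maximal ideals.  Both sides are compared
    through separation: for distinct maximal ideals M, M' and x nonzero there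
    are s outside M and t outside M' with st divisible by x.  Divisoriality of
    well-chosen ideals gives principal maximal ideals, then separation, then
    the finiteness of the set of maximal ideals containing x
    (divisorial_maximal_principal, divisorial_separated,
    divisorial_finite_character).  In the other direction, separation and the
    finiteness condition turn a local witness that z is not in an ideal J into
    a global element of the dual of J not carrying z into the domain
    (h_local_divisorial). *)

(** * Chains and maximal elements *)

Lemma exists_maximal_above (T : Type) (good : set (set T)) (I : set T) :
  good I ->
  (forall C : set (set T), C !=set0 -> C `<=` good -> total_on C subset ->
     good (\bigcup_(X in C) X)) ->
  exists M, [/\ good M, I `<=` M & forall J, good J -> M `<=` J -> J = M].
Proof.
move=> goodI chain_good.
(* Adding I to every member lets the empty chain have a union. *)
have [|X [goodX maxX]] := @Zorn_bigcup T [set X | good (I `|` X)].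
  move=> C Cgood totC /=; have [->|C0] := eqVneq C set0.
    by rewrite bigcup_set0 setU0.
  have /set0P [X0 CX0] := C0.
  have -> : I `|` \bigcup_(X in C) X =
            \bigcup_(Y in [set I `|` X | X in C]) Y.
    apply/seteqP; split=> x /=.
      case=> [Ix|[X CX Xx]]; first by exists (I `|` X0); [exists X0|left].
      by exists (I `|` X); [exists X|right].
    by case=> _ [X CX <-] [Ix|Xx]; [left|right; exists X].
  apply: chain_good; first by exists (I `|` X0), X0.
    by move=> _ [X CX <-]; exact: Cgood.
  move=> _ _ [X CX <-] [Y CY <-].
  by have [XY|YX] := totC X Y CX CY; [left|right]; apply: setUS.
exists (I `|` X); split; [exact: goodX|by move=> x; left|].
move=> J goodJ IXJ; apply: contrapT => neqJ.
have IJ : I `|` J = J by apply/setUidPr => x Ix; apply: IXJ; left.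
apply: (maxX J); last by rewrite /= IJ.
split; first by move=> x Xx; apply: IXJ; right.
move=> JX; apply: neqJ; apply/seteqP; split=> //.
by move=> x Jx; right; apply: JX.
Qed.

(** * Modules over a subring of a field *)

Definition subring (L : fieldType) (A : set L) : Prop :=
  [/\ A 1, forall x y, A x -> A y -> A (x - y)
    & forall x y, A x -> A y -> A (x * y)].

Section Modules.
Variables (L : fieldType) (A : set L).
Hypothesis ringA : subring A.
Implicit Types (E F G I J M P : set L) (f g : {poly L}).

Lemma subring1 : A 1. Proof. by case: ringA. Qed.

Lemma subringB x y : A x -> A y -> A (x - y).
Proof. by case: ringA => _ + _; apply. Qed.

Lemma subringM x y : A x -> A y -> A (x * y).
Proof. by case: ringA => _ _; apply. Qed.

Lemma subring0 : A 0.
Proof. by rewrite -(subrr 1); apply: subringB subring1 subring1. Qed.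

Lemma subringN x : A x -> A (- x).
Proof. by move=> Ax; rewrite -sub0r; apply: subringB => //;
  exact: subring0. Qed.

Lemma subringD x y : A x -> A y -> A (x + y).
Proof. by move=> Ax Ay; rewrite -[y]opprK; apply: subringB => //;
  exact: subringN. Qed.

Lemma submodule0 E : submodule A E -> E 0. Proof. by case. Qed.

Lemma submoduleD E x y : submodule A E -> E x -> E y -> E (x + y).
Proof. by move=> [_ H] Ex Ey; rewrite -[x]mul1r; apply: H => //;
  exact: subring1. Qed.

Lemma submoduleZ E a x : submodule A E -> A a -> E x -> E (a * x).
Proof. by move=> [E0 H] Aa Ex; rewrite -[_ * _]addr0; apply: H. Qed.

Lemma submoduleN E x : submodule A E -> E x -> E (- x).
Proof.
by move=> mE Ex; rewrite -mulN1r; apply: submoduleZ => //;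
  apply/subringN/subring1.
Qed.

Lemma submodule_sum E (I : Type) (r : seq I) (Q : pred I) (F : I -> L) :
  submodule A E -> (forall i, Q i -> E (F i)) -> E (\sum_(i <- r | Q i) F i).
Proof.
move=> mE EF; elim/big_ind: _ => //; first exact: submodule0.
by move=> x y; exact: submoduleD.
Qed.

Lemma submodule_self : submodule A A.
Proof.
split; first exact: subring0.
by move=> a x y Aa Ax Ay; apply: subringD => //; exact: subringM.
Qed.

Lemma subring_sum (I : Type) (r : seq I) (Q : pred I) (F : I -> L) :
  (forall i, Q i -> A (F i)) -> A (\sum_(i <- r | Q i) F i).
Proof. exact: submodule_sum submodule_self. Qed.

Lemma submodule_colon E F : submodule A E -> submodule A (colon E F).
Proof.
move=> mE; split=> [y _|a x y Aa Ex Ey z Fz]; first by rewrite mul0r;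
  apply: submodule0.
rewrite mulrDl -mulrA; apply: submoduleD (mE) _ (Ey z Fz).
exact: submoduleZ mE Aa (Ex z Fz).
Qed.

Lemma submodule_preim E z : submodule A E -> submodule A [set x | E (z * x)].
Proof.
move=> mE; split=> [|a x y Aa Ex Ey] /=; first by rewrite mulr0;
  apply: submodule0.
by rewrite mulrDr mulrCA; apply: submoduleD => //; apply: submoduleZ.
Qed.

Lemma submoduleI E F : submodule A E -> submodule A F -> submodule A (E `&` F).
Proof.
move=> mE mF; split=> [|a x y Aa [Ex Fx] [Ey Fy]].
  by split; apply: submodule0.
by split; [case: mE|case: mF] => _; apply.
Qed.

Lemma submodule_span (G : set L) : submodule A (span A G).
Proof.
split=> [E [mE _]|a x y Aa Gx Gy E GE]; first exact: submodule0.
by case: (GE) => mE _; case: (mE) => _; apply=> //; [apply: Gx|apply: Gy].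
Qed.

Lemma span_sub (G : set L) E : submodule A E -> G `<=` E -> span A G `<=` E.
Proof. exact: smallest_sub. Qed.

Lemma mem_span (G : set L) x : G x -> span A G x.
Proof. exact: sub_gen_smallest. Qed.

Lemma span_le (G H : set L) : G `<=` span A H -> span A G `<=` span A H.
Proof. by apply: span_sub; exact: submodule_span. Qed.

Lemma mem_mprod E F x y : E x -> F y -> mprod A E F (x * y).
Proof. by move=> Ex Fy; apply: mem_span; exists x => //; exists y. Qed.

Lemma mprod_sub E F G : submodule A G ->
  (forall x y, E x -> F y -> G (x * y)) -> mprod A E F `<=` G.
Proof. by move=> mG EFG; apply: span_sub => // _ [x Ex [y Fy <-]];
  exact: EFG. Qed.

Lemma mprodC E F : mprod A E F = mprod A F E.
Proof.
by apply/seteqP; split; apply: mprod_sub (submodule_span _) _ => x y Ex Fy;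
  rewrite mulrC; apply: mem_mprod.
Qed.

Lemma mprod_ringl E : submodule A E -> mprod A A E = E.
Proof.
move=> mE; apply/seteqP; split.
  by apply: mprod_sub => // a x; exact: submoduleZ.
by move=> x Ex; rewrite -[x]mul1r; apply: mem_mprod => //; exact: subring1.
Qed.

Lemma mprod_span (G H : set L) :
  mprod A (span A G) (span A H) = span A [set x * y | x in G & y in H].
Proof.
apply/seteqP; split.
  apply: mprod_sub (submodule_span _) _ => x y Gx.
  apply: (@span_sub H [set y | span A [set x * y | x in G & y in H] (x * y)] _ _ y).
    exact/submodule_preim/submodule_span.
  move=> h Hh /=; rewrite mulrC.
  apply: (@span_sub G [set x | span A [set x * y | x in G & y in H] (h * x)] _ _ x Gx).
    exact/submodule_preim/submodule_span.
  by move=> g Gg /=; rewrite mulrC; apply: mem_span; exists g => //; exists h.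
apply: span_sub (submodule_span _) _ => _ [x Gx [y Hy <-]].
by apply: mem_mprod; apply: mem_span.
Qed.

Lemma colon_span E (G : set L) : submodule A E -> colon E (span A G) = colon E G.
Proof.
move=> mE; apply/seteqP; split=> x xG y; first by move=> Gy; apply: xG;
  apply: mem_span.
by apply: (@span_sub G [set y | E (x * y)]) => //; exact: submodule_preim.
Qed.

Lemma colon_anti E F G : F `<=` G -> colon E G `<=` colon E F.
Proof. by move=> FG x xG y Fy; apply: xG; apply: FG. Qed.

Lemma op_v_ext E : E `<=` op_v A E.
Proof. by move=> x Ex y yE; rewrite mulrC; apply: yE. Qed.

Lemma op_v_mono E F : E `<=` F -> op_v A E `<=` op_v A F.
Proof. by move=> EF; do 2 apply: colon_anti. Qed.

Lemma colon_op_v E : colon A (op_v A E) = colon A E.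
Proof.
apply/seteqP; split; first by apply: colon_anti; exact: op_v_ext.
by move=> x xE y; rewrite mulrC; apply.
Qed.

Lemma op_v_idem E : op_v A (op_v A E) = op_v A E.
Proof. by rewrite /op_v -/(op_v A E) colon_op_v. Qed.

Lemma op_v_least E F : E `<=` op_v A F -> op_v A E `<=` op_v A F.
Proof. by move=> EF; rewrite -(op_v_idem F); apply: op_v_mono. Qed.

Lemma submodule_op_v E : submodule A (op_v A E).
Proof. exact/submodule_colon/submodule_self. Qed.

Lemma op_v_ring : op_v A A = A.
Proof.
apply/seteqP; split; last exact: op_v_ext.
move=> x vx; rewrite -[x]mulr1; apply: vx => y Ay; by rewrite mul1r.
Qed.

Lemma op_v_eq_ring E : E `<=` A -> op_v A E 1 -> op_v A E = A.
Proof.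
move=> EA E1; apply/seteqP; split; first by rewrite -{2}op_v_ring;
  apply: op_v_mono.
by move=> a Aa; rewrite -[a]mulr1; apply: (submoduleZ (submodule_op_v E) Aa E1).
Qed.

(** Finitely generated fractional ideals are the contents of nonzero
    polynomials over the field, so that polynomials stand for generating
    families, and joining two families amounts to shifting exponents. *)
Definition cont (g : {poly L}) : set L := span A [set g`_i | i in [set: nat]].

Lemma submodule_cont g : submodule A (cont g). Proof. exact: submodule_span. Qed.

Lemma mem_cont g i : cont g g`_i. Proof. by apply: mem_span; exists i. Qed.

Lemma cont_sub g E : submodule A E -> (forall i, E g`_i) -> cont g `<=` E.
Proof. by move=> mE Eg; apply: span_sub => // _ [i _ <-]. Qed.

Lemma cont_Poly (s : seq L) : span A [set` s] = cont (Poly s).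
Proof.
apply/seteqP; split.
  apply: span_sub (submodule_cont _) _ => x /= /(nthP 0) [i _ <-].
  by rewrite -coef_Poly; exact: mem_cont.
apply: cont_sub => [|i]; first exact: submodule_span.
rewrite coef_Poly; have [lti|lei] := ltnP i (size s).
  by apply: mem_span; rewrite /= mem_nth.
by rewrite nth_default //; exact: (submodule0 (submodule_span _)).
Qed.

Lemma cont_seq g : cont g = span A [set` (g : seq L)].
Proof. by rewrite cont_Poly polyseqK. Qed.

Lemma cont_scale z g : cont (z *: g) = [set z * x | x in cont g].
Proof.
apply/seteqP; split.
  apply: cont_sub => [|i]; last by rewrite coefZ; exists g`_i => //;
    exact: mem_cont.
  split; first by exists 0;
    [exact: (submodule0 (submodule_cont _))|rewrite mulr0].
  move=> a _ _ Aa [x gx <-] [y gy <-]; exists (a * x + y); last by ring.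
  by case: (submodule_cont g) => _; apply.
move=> _ [x gx <-].
have subE : cont g `<=` [set x | cont (z *: g) (z * x)].
  apply: cont_sub => [|i /=]; last by rewrite -coefZ; exact: mem_cont.
  exact/submodule_preim/submodule_cont.
exact: subE.
Qed.

Lemma colon_contP E g x :
  submodule A E -> colon E (cont g) x <-> forall i, E (x * g`_i).
Proof.
move=> mE; rewrite colon_span //; split=> [xg i|xg _ [i _ <-]] //.
by apply: xg; exists i.
Qed.

Lemma cont_poly0 x : cont 0 x -> x = 0.
Proof.
apply: (@cont_sub 0 [set 0]) => [|i]; last by rewrite coef0.
by split=> // a y z _ -> ->; rewrite mulr0 addr0.
Qed.

Lemma cont_neq0 g : g != 0 -> nonzero (cont g).
Proof.
by move=> g0; exists (lead_coef g); [exact: mem_cont|rewrite lead_coef_eq0].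
Qed.

(** Shifting q beyond the degree of p keeps the coefficients of both, so a sum of
    two contents is a content. *)
Lemma cont_join (p q : {poly L}) m : (size p <= m)%N ->
  [/\ cont p `<=` cont (p + 'X^m * q), cont q `<=` cont (p + 'X^m * q) &
   forall E, submodule A E -> cont p `<=` E -> cont q `<=` E ->
     cont (p + 'X^m * q) `<=` E].
Proof.
move=> pm; split.
- apply: cont_sub => [|i]; first exact: submodule_cont.
  have [ltim|leim] := ltnP i m; last first.
    by rewrite [p`_i]nth_default ?(leq_trans pm) //;
      exact: (submodule0 (submodule_cont _)).
  have -> : p`_i = (p + 'X^m * q)`_i by rewrite coefD coefXnM ltim addr0.
  exact: mem_cont.
- apply: cont_sub => [|i]; first exact: submodule_cont.
  have -> : q`_i = (p + 'X^m * q)`_(m + i).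
    by rewrite coefD coefXnM ltnNge leq_addr /= addKn [p`_ _]nth_default ?add0r // (leq_trans pm) ?leq_addr.
  exact: mem_cont.
move=> E mE pE qE; apply: cont_sub => // i.
rewrite coefD coefXnM; apply: submoduleD => //; first by apply: pE;
  exact: mem_cont.
by case: ifP => _; [apply: submodule0|apply: qE; apply: mem_cont].
Qed.

End Modules.

Arguments mem_cont {L} A g i.

(** * Primitive polynomials *)

Definition quotient_field (L : fieldType) (A : set L) : Prop :=
  forall x : L, exists a b, [/\ A a, A b, b != 0 & x = a / b].

Definition coefs_in (L : fieldType) (A : set L) (f : {poly L}) : Prop :=
  forall i, A f`_i.

(** For nonzero g in A[X] the last clause says that c(g) has trivial dual,
    which is the same as c(g)^v = A. *)
Definition vprim (L : fieldType) (A : set L) (g : {poly L}) : Prop :=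
  [/\ g != 0, coefs_in A g & forall x, coefs_in A (x *: g) -> A x].

Section Primitive.
Variables (L : fieldType) (A : set L).
Hypothesis ringA : subring A.
Implicit Types (E : set L) (f g p q : {poly L}).

Lemma coefs_inD f g : coefs_in A f -> coefs_in A g -> coefs_in A (f + g).
Proof. by move=> Af Ag i; rewrite coefD; apply: (subringD ringA). Qed.

Lemma coefs_inB f g : coefs_in A f -> coefs_in A g -> coefs_in A (f - g).
Proof. by move=> Af Ag i; rewrite coefB; apply: (subringB ringA). Qed.

Lemma coefs_inZ a f : A a -> coefs_in A f -> coefs_in A (a *: f).
Proof. by move=> Aa Af i; rewrite coefZ; apply: (subringM ringA). Qed.

Lemma submodule_coefs_inM E f g : submodule A E ->
  coefs_in A f -> coefs_in E g -> coefs_in E (f * g).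
Proof.
move=> mE Af Eg i; rewrite coefM; apply: (submodule_sum ringA) => // j _.
exact: submoduleZ mE (Af _) (Eg _).
Qed.

Lemma coefs_inM f g : coefs_in A f -> coefs_in A g -> coefs_in A (f * g).
Proof. by apply: submodule_coefs_inM; exact: (submodule_self ringA). Qed.

Lemma coefs_inC c : A c -> coefs_in A c%:P.
Proof. by move=> Ac i; rewrite coefC; case: ifP => // _;
  exact: (subring0 ringA). Qed.

Lemma coefs_inXn n : coefs_in A 'X^n.
Proof.
by move=> i; rewrite coefXn; case: eqP => _;
  [exact: (subring1 ringA)|exact: (subring0 ringA)].
Qed.

Lemma coefs_in1 : coefs_in A 1.
Proof. by rewrite -(expr0 'X); exact: coefs_inXn. Qed.

Lemma vprim1 : vprim A 1.
Proof.
split; [exact: oner_neq0|exact: coefs_in1|].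
by move=> x /(_ 0%N); rewrite coefZ coef1 mulr1.
Qed.

Lemma op_v_contP g x :
  op_v A (cont A g) x <-> forall y, coefs_in A (y *: g) -> A (x * y).
Proof.
have mA := submodule_self ringA; split=> xg y yg; apply: xg.
  by apply/(colon_contP ringA) => // i; rewrite -coefZ.
by move=> i; rewrite coefZ; apply: yg; exact: mem_cont.
Qed.

Lemma vprimP g : g != 0 -> coefs_in A g ->
  vprim A g <-> op_v A (cont A g) = A.
Proof.
move=> g0 Ag; split=> [[_ _ prim_g]|cg].
  apply: (op_v_eq_ring ringA) => //;
    first exact: cont_sub (submodule_self ringA) Ag.
  by apply/op_v_contP => y /prim_g; rewrite mul1r.
split=> // x xg; rewrite -[x]mul1r.
by move: (subring1 ringA); rewrite -{1}cg => /op_v_contP; apply.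
Qed.

Lemma coef_mul_top p q a b : (size p <= a.+1)%N -> (size q <= b.+1)%N ->
  (p * q)`_(a + b) = p`_a * q`_b.
Proof.
move=> pa qb; have lta : (a < (a + b).+1)%N by rewrite ltnS leq_addr.
rewrite coefM (bigD1 (Ordinal lta)) //= addKn big1 ?addr0 // => i neqi.
have [ia|ai] := ltnP a i; first by rewrite nth_default ?mul0r // (leq_trans pa).
have {neqi} {}ai : (i < a)%N by rewrite ltn_neqAle ai andbT; apply: contra neqi.
by rewrite [q`__]nth_default ?mulr0 // (leq_trans qb) // ltn_subRL ltn_add2r.
Qed.

Lemma coefs_in_mul_coefs p f :
  (forall i, coefs_in A (p`_i *: f)) -> coefs_in A (p * f).
Proof.
move=> pf i; rewrite coefM; apply: (subring_sum ringA) => j _.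
by rewrite -coefZ; apply: pf.
Qed.

(** A coefficient of g whose successors carry f into A[X] multiplies the leading
    term of f into A[X], hence also the rest of f, by induction on the size of
    f; therefore all coefficients of g carry f into A[X]. *)
Lemma vprim_gauss f g : vprim A g -> coefs_in A (f * g) -> coefs_in A f.
Proof.
move=> [g0 Ag prim_g].
have [n] := ubnP (size f); elim: n f => // n IHn f szf Afg.
suff gf : forall k j, (size g <= j + k)%N -> coefs_in A (g`_j *: f).
  move=> i; apply: prim_g => j; rewrite coefZ mulrC -coefZ.
  by apply: (gf (size g)); rewrite leq_addl.
elim=> [|k IHk] j szg.
  rewrite nth_default ?scale0r; last by rewrite addn0 in szg.
  by move=> i; rewrite coef0; exact: (subring0 ringA).
have [->|f0] := eqVneq f 0.
  by rewrite scaler0 => i; rewrite coef0; exact: (subring0 ringA).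
pose low := take_poly j.+1 g; pose high := drop_poly j.+1 g.
have Alow : coefs_in A (low * f).
  have -> : low * f = f * g - 'X^(j.+1) * (high * f).
    by rewrite -{1}(poly_take_drop j.+1 g) -/low -/high; ring.
  apply: coefs_inB => //; apply: coefs_inM; first exact: coefs_inXn.
  apply: coefs_in_mul_coefs => i; rewrite coef_drop_poly; apply: IHk.
  by rewrite (leq_trans szg) // !addnS addSn ltnS -addnA leq_addl.
pose m := (size f).-1;
  have szm : size f = m.+1 by rewrite prednK ?size_poly_gt0.
have Atop : A (g`_j * f`_m).
  have := Alow (j + m)%N.
  rewrite coef_mul_top ?szm ?size_take_poly // coef_take_poly ltnSn.
  by [].
have Arest : coefs_in A (g`_j *: (f - f`_m *: 'X^m)).
  apply: IHn.
    apply: leq_ltn_trans (size_scale_leq _ _) _.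
    suff : (size (f - f`_m *: 'X^m)%R <= m)%N by move/leq_ltn_trans; apply;
      rewrite -ltnS -szm.
    apply/leq_sizeP => i mi; rewrite coefB coefZ coefXn.
    have [->|neqi] := eqVneq i m; first by rewrite mulr1 subrr.
    by rewrite mulr0 subr0 nth_default // szm ltn_neqAle eq_sym neqi.
  have -> : g`_j *: (f - f`_m *: 'X^m) * g =
            g`_j *: (f * g) - (g`_j * f`_m) *: ('X^m * g).
    by rewrite -!mul_polyC rmorphM /=; ring.
  apply: coefs_inB; apply: coefs_inZ => //.
  by apply: coefs_inM => //; exact: coefs_inXn.
have -> : g`_j *: f = g`_j *: (f - f`_m *: 'X^m) + (g`_j * f`_m) *: 'X^m.
  by rewrite scalerBr scalerA subrK.
by apply: coefs_inD => //; apply: coefs_inZ => //; exact: coefs_inXn.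
Qed.

Lemma vprimM f g : vprim A f -> vprim A g -> vprim A (f * g).
Proof.
move=> pf pg; have [f0 Af primf] := pf; have [g0 Ag _] := pg.
split; [by rewrite mulf_neq0|exact: coefs_inM|].
by move=> x; rewrite scalerAl => /(vprim_gauss pg); exact: primf.
Qed.

End Primitive.

(** * Finitely generated fractional ideals *)

Section FinitelyGenerated.
Variables (L : fieldType) (A : set L).
Hypothesis ringA : subring A.
Hypothesis fracA : quotient_field A.
Implicit Types (E F G H I J Q : set L) (f g p q : {poly L}).

Lemma common_denominator g : exists d, [/\ A d, d != 0 & coefs_in A (d *: g)].
Proof.
suff [d [Ad d0 dg]] : exists d, [/\ A d, d != 0 &
    forall i, (i < size g)%N -> A (d * g`_i)].
  exists d; split=> // i; rewrite coefZ.
  have [/dg//|lei] := ltnP i (size g).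
  by rewrite nth_default // mulr0; exact: (subring0 ringA).
elim: (size g) => [|n [d [Ad d0 dg]]].
  by exists 1; split=> //; [exact: (subring1 ringA)|exact: oner_neq0].
have [a [b [Aa Ab b0 gn]]] := fracA g`_n.
exists (d * b); split; [exact: (subringM ringA)|by rewrite mulf_neq0|].
move=> i; rewrite ltnS leq_eqVlt => /predU1P[->|/dg Adg].
  have -> : d * b * g`_n = d * a by rewrite gn; field.
  exact: (subringM ringA).
by rewrite mulrAC; apply: (subringM ringA).
Qed.

Lemma fg_frac_ideal_cont g : g != 0 -> fg_frac_ideal A (cont A g).
Proof.
move=> g0; split; last by exists g; exact: cont_seq.
split; [exact: submodule_cont|exact: cont_neq0|].
have [d [Ad d0 dg]] := common_denominator g; exists d; split=> //.
apply: cont_sub => [|i]; last by rewrite -coefZ.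
exact/(submodule_preim ringA)/(submodule_self ringA).
Qed.

Lemma fg_frac_idealP F :
  fg_frac_ideal A F <-> exists2 g, g != 0 & F = cont A g.
Proof.
split=> [[[_ [x Fx x0] _] [s Fs]]|[g g0 ->]]; last exact: fg_frac_ideal_cont.
exists (Poly s); last by rewrite Fs; exact: cont_Poly.
apply: contraNneq x0 => s0; rewrite Fs cont_Poly s0 in Fx.
by rewrite (cont_poly0 Fx).
Qed.

Lemma frac_ideal_mprod E F :
  frac_ideal A E -> frac_ideal A F -> frac_ideal A (mprod A E F).
Proof.
move=> [mE [e Ee e0] [d [Ad d0 dE]]] [mF [f Ff f0] [d' [Ad' d'0 dF]]].
split; first exact: submodule_span.
  by exists (e * f); [exact: mem_mprod|rewrite mulf_neq0].
exists (d * d'); split; [exact: (subringM ringA)|by rewrite mulf_neq0|].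
apply: mprod_sub => [|x y Ex Fy /=].
  exact/(submodule_preim ringA)/(submodule_self ringA).
by rewrite mulrACA; apply: (subringM ringA); [exact: dE|exact: dF].
Qed.

Lemma fg_frac_ideal_mprod E F :
  fg_frac_ideal A E -> fg_frac_ideal A F -> fg_frac_ideal A (mprod A E F).
Proof.
move=> [fE [s Es]] [fF [t Ft]]; split; first exact: frac_ideal_mprod.
exists [seq x * y | x <- s, y <- t]; rewrite Es Ft (mprod_span ringA);
  congr (span _ _).
apply/seteqP; split=> z /=.
  by move=> [x xs [y yt <-]]; apply/allpairsP; exists (x, y).
by move=> /allpairsP [[x y] [xs yt ->]]; exists x => //; exists y.
Qed.

Lemma cont1 : cont A 1 = A.
Proof.
apply/seteqP; split.
  exact: (cont_sub (submodule_self ringA) (coefs_in1 ringA)).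
move=> a Aa; rewrite -[a]mulr1; apply: (submoduleZ (submodule_cont A 1) Aa).
by have := mem_cont A 1 0; rewrite coef1.
Qed.

Lemma fg_frac_ideal_ring : fg_frac_ideal A A.
Proof. by rewrite -{2}cont1; apply: fg_frac_ideal_cont; exact: oner_neq0. Qed.

Lemma mprod_self_sub_colon F : mprod A F (colon A F) `<=` A.
Proof.
apply: mprod_sub => [|x y Fx yF]; first exact: (submodule_self ringA).
by rewrite mulrC; apply: yF.
Qed.

(** The dual of F F^-1 is (F^v : F), so the v-domain condition says that no
    element outside A multiplies F into F^v. *)
Lemma v_domainP : v_domain A <->
  forall F, fg_frac_ideal A F -> colon (op_v A F) F `<=` A.
Proof.
split=> [vA F fgF x xF|vA F fgF].
  rewrite -[x]mul1r; move: (subring1 ringA); rewrite -{1}(vA F fgF); apply.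
  move=> y; rewrite -[A _]/([set y | A (x * y)] y); apply: mprod_sub => /=.
    exact/(submodule_preim ringA)/(submodule_self ringA).
  by move=> f z Ff zF; rewrite mulrA; apply: xF.
apply: (op_v_eq_ring ringA); first exact: mprod_self_sub_colon.
move=> x xF; rewrite mul1r; apply: (vA F fgF) => f Ff z zF.
by rewrite -mulrA; apply: xF; apply: mem_mprod.
Qed.

(** * The t-operation *)

Lemma op_tP E x : submodule A E ->
  op_t A E x <-> exists g, [/\ g != 0, coefs_in E g & op_v A (cont A g) x].
Proof.
move=> mE; split=> [[F [fgF FE] xF]|[g [g0 Eg xg]]].
  have [g g0 defF] := ((fg_frac_idealP F).1) fgF; exists g; split=> //.
    by move=> i; apply: FE; rewrite defF; apply: mem_cont.
  by rewrite -defF.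
exists (cont A g) => //; split; first exact: fg_frac_ideal_cont.
by apply: cont_sub mE _.
Qed.

Lemma op_t_sub_v E : op_t A E `<=` op_v A E.
Proof. by move=> x [F [_ FE]]; exact: op_v_mono. Qed.

Lemma op_t_ext E : submodule A E -> nonzero E -> E `<=` op_t A E.
Proof.
move=> mE [e Ee e0] x Ex.
(* x may be 0, whereas finitely generated fractional ideals are nonzero *)
pose y := if x == 0 then e else x.
have [y0 Ey yx] : [/\ y != 0, E y & cont A y%:P x].
  have yy : cont A y%:P y by have := mem_cont A y%:P 0; rewrite coefC.
  rewrite /y in yy *; case: eqVneq yy => [->|x0] yy; split=> //.
  exact: submodule0 (submodule_cont _ _).
apply/(op_tP _ mE); exists y%:P; split; first by rewrite polyC_eq0.
  by move=> i; rewrite coefC; case: ifP => // _; exact: submodule0 mE.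
exact: op_v_ext.
Qed.

(** The union defining E^t is directed, because contents can be joined. *)
Lemma op_t_coefs E h : submodule A E -> nonzero E -> coefs_in (op_t A E) h ->
  exists g, [/\ g != 0, coefs_in E g & coefs_in (op_v A (cont A g)) h].
Proof.
move=> mE [e Ee e0] Eh.
suff [g [g0 Eg gh]] : exists g, [/\ g != 0, coefs_in E g &
    forall i, (i < size h)%N -> op_v A (cont A g) h`_i].
  exists g; split=> // i; have [/gh//|lei] := ltnP i (size h).
  by rewrite nth_default //; apply: submodule0; exact: (submodule_op_v ringA).
elim: (size h) => [|n [g [g0 Eg gh]]].
  exists e%:P; split=> //; first by rewrite polyC_eq0.
  by move=> i; rewrite coefC; case: ifP => // _; exact: submodule0 mE.
have [p [p0 Ep hp]] := (op_tP h`_n mE).1 (Eh n).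
have [gG pG sub] := cont_join ringA p (leqnn (size g)).
exists (g + 'X^(size g) * p); split.
- apply: contraNneq g0 => g0.
  apply/eqP/polyP => i; rewrite coef0.
  by have := gG _ (mem_cont A g i); rewrite g0 => /cont_poly0.
- move=> i; have := sub E mE (cont_sub mE Eg) (cont_sub mE Ep).
  by apply; exact: mem_cont.
move=> i; rewrite ltnS leq_eqVlt => /predU1P[->|/gh].
  exact: (op_v_mono pG).
exact: (op_v_mono gG).
Qed.

Lemma op_t_idem E : submodule A E -> nonzero E -> submodule A (op_t A E) ->
  op_t A (op_t A E) = op_t A E.
Proof.
move=> mE E0 mtE; apply/seteqP; split=> x; last first.
  apply: op_t_ext => //; have [e Ee e0] := E0.
  by exists e => //; exact: op_t_ext.
move=> /(op_tP _ mtE) [h [h0 Eh xh]].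
have [g [g0 Eg gh]] := op_t_coefs mE E0 Eh.
apply/(op_tP _ mE); exists g; split=> //; apply: op_v_least xh.
by apply: cont_sub => //; exact: (submodule_op_v ringA).
Qed.

Lemma submodule_op_t E : submodule A E -> nonzero E -> submodule A (op_t A E).
Proof.
move=> mE E0; split=> [|a x y Aa Ex Ey].
  by apply: op_t_ext => //; exact: submodule0 mE.
have Exy : coefs_in (op_t A E) (Poly [:: x; y]).
  move=> [|[|i]]; rewrite coef_Poly //= nth_nil.
  by apply: op_t_ext => //; exact: submodule0 mE.
have [g [g0 Eg gxy]] := op_t_coefs mE E0 Exy.
apply/(op_tP _ mE); exists g; split=> //.
have [_] := (submodule_op_v ringA) (cont A g); apply=> //.
  by have := gxy 0%N; rewrite coef_Poly.
by have := gxy 1%N; rewrite coef_Poly.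
Qed.

End FinitelyGenerated.

(** * Maximal t-ideals and the w-operation *)

(** The finiteness that makes a chain of t-ideals have a t-ideal as union. *)
Lemma coefs_in_chain (L : fieldType) (C : set (set L)) (g : {poly L}) :
  C !=set0 -> total_on C subset -> (forall J, C J -> J 0) ->
  coefs_in (\bigcup_(J in C) J) g -> exists2 J, C J & coefs_in J g.
Proof.
move=> [J0 CJ0] totC C0 Cg.
suff [J CJ Jg] : exists2 J, C J & forall i, (i < size g)%N -> J g`_i.
  exists J => // i; have [/Jg//|lei] := ltnP i (size g).
  by rewrite nth_default //; exact: C0.
elim: (size g) => [|n [J CJ Jg]]; first by exists J0.
have [J' CJ' J'n] := Cg n.
have [JJ'|J'J] := totC J J' CJ CJ'.
  by exists J' => // i; rewrite ltnS leq_eqVlt => /predU1P[->|/Jg/JJ'].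
by exists J => // i; rewrite ltnS leq_eqVlt => /predU1P[->|/Jg//]; exact: J'J.
Qed.

Lemma ideal_eq (L : fieldType) (A I : set L) : ideal A I -> I 1 -> I = A.
Proof.
move=> [mI IA] I1; apply/seteqP; split=> // a Aa.
by rewrite -[a]mulr1; apply: submoduleZ mI Aa I1.
Qed.

Lemma proper_idealP (L : fieldType) (A : set L) (ringA : subring A) (I : set L) :
  proper_ideal A I <-> ideal A I /\ ~ I 1.
Proof.
split=> [[idI neqI]|[idI I1]]; split=> //; first by move/(ideal_eq idI).
by move=> IA; apply: I1; rewrite IA; exact: (subring1 ringA).
Qed.

Lemma ideal_chain (L : fieldType) (A : set L) (ringA : subring A)
    (C : set (set L)) :
  C !=set0 -> total_on C subset -> C `<=` proper_ideal A ->
  proper_ideal A (\bigcup_(J in C) J).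
Proof.
move=> [J0 CJ0] totC Cprop.
have Cid J : C J -> ideal A J by move=> /Cprop [].
apply/(proper_idealP ringA); split; last first.
  by move=> [J CJ J1]; have /(proper_idealP ringA) [_] := Cprop J CJ.
split; last by move=> x [J CJ Jx]; have [_] := Cid J CJ; apply.
split; first by exists J0 => //; have [[]] := Cid J0 CJ0.
move=> a x y Aa [J CJ Jx] [J' CJ' J'y].
have [JJ'|J'J] := totC J J' CJ CJ'.
  by exists J' => //; have [[_ mJ] _] := Cid J' CJ'; apply: mJ => //;
    exact: JJ'.
by exists J => //; have [[_ mJ] _] := Cid J CJ; apply: mJ => //; exact: J'J.
Qed.

(** Denominators outside a prime multiply, so E A_Q consists of single
    fractions. *)
Lemma mprod_localizationP (L : fieldType) (A : set L) (ringA : subring A)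
    (Q E : set L) (x : L) : prime_ideal A Q -> submodule A E ->
  mprod A E (localization A Q) x <-> exists s, [/\ A s, ~ Q s & E (s * x)].
Proof.
move=> [/(proper_idealP ringA) [[mQ QA] Q1] primeQ] mE; split; last first.
  move=> [s [As Qs Esx]]; have s0 : s != 0.
    by apply: contra_notN Qs => /eqP ->; exact: submodule0 mQ.
  have -> : x = (s * x) * (1 / s) by field.
  by apply: mem_mprod => //; exists 1, s; split=> //; exact: (subring1 ringA).
rewrite -[X in _ -> X]/([set x | exists s, [/\ A s, ~ Q s & E (s * x)]] x).
move: x; apply: mprod_sub => [|e _ Ee [a [s [Aa As Qs ->]]]]; last first.
  have s0 : s != 0.
    by apply: contra_notN Qs => /eqP ->; exact: submodule0 mQ.
  exists s; split=> //; have -> : s * (e * (a / s)) = a * e by field.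
  exact: submoduleZ mE Aa Ee.
split; first by exists 1; split=> //; [exact: (subring1 ringA)|rewrite mulr0;
  exact: submodule0 mE].
move=> a x y Aa [s [As Qs Esx]] [s' [As' Qs' Esy]].
exists (s * s'); split; first by apply: (subringM ringA).
  by move=> /(primeQ _ _ As As') [].
have -> : s * s' * (a * x + y) = (s' * a) * (s * x) + s * (s' * y) by ring.
by apply: (submoduleD ringA mE); apply: (submoduleZ mE) => //;
  apply: (subringM ringA).
Qed.

Section TMaximal.
Variables (L : fieldType) (A : set L).
Hypothesis ringA : subring A.
Hypothesis fracA : quotient_field A.
Implicit Types (E F G H I J Q : set L) (f g p q : {poly L}).

Lemma op_t_sub_ring I : I `<=` A -> op_t A I `<=` A.
Proof. by move=> IA x /op_t_sub_v /(op_v_mono IA); rewrite op_v_ring. Qed.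

Lemma exists_t_maximal I : ideal A I -> nonzero I -> ~ op_t A I 1 ->
  exists2 Q, t_maximal A Q & I `<=` Q.
Proof.
move=> [mI IA] I0 tI1; have mtI := submodule_op_t ringA fracA mI I0.
have tI : proper_t_ideal A (op_t A I).
  split; last exact: (op_t_idem ringA fracA).
    by apply/(proper_idealP ringA); split=> //; split=> //;
      exact: op_t_sub_ring.
  by have [e Ie e0] := I0; exists e => //; exact: (op_t_ext ringA fracA).
have [C C0 Ct totC|Q [Qt IQ maxQ]] := exists_maximal_above (good :=
  proper_t_ideal A) tI.
  have Cprop : C `<=` proper_ideal A by move=> J /Ct [].
  have propU := ideal_chain ringA C0 totC Cprop.
  have mU : submodule A (\bigcup_(J in C) J) by case: propU => [[]].
  have U0 : nonzero (\bigcup_(J in C) J).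
    have [J CJ] := C0; have [_ [e Je e0] _] := Ct J CJ.
    by exists e => //; exists J.
  split=> //; apply/seteqP; split; last exact: (op_t_ext ringA fracA).
  move=> x /(op_tP ringA fracA _ mU) [g [g0 Ug xg]].
  have [J CJ Jg] : exists2 J, C J & coefs_in J g.
    apply: coefs_in_chain => // J CJ.
    by have [[mJ _] _] := Cprop J CJ; exact: submodule0 mJ.
  exists J => //; have [[[mJ _] _] _ <-] := Ct J CJ.
  by apply/(op_tP ringA fracA _ mJ); exists g.
by exists Q; [split|apply: subset_trans IQ; exact: (op_t_ext ringA fracA)].
Qed.

(** If x is not in Q, then the t-closure of Q + xA contains 1; multiplying a
    finitely generated witness of this by y moves it into Q. *)
Lemma t_maximal_prime Q : t_maximal A Q -> prime_ideal A Q.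
Proof.
move=> [[propQ Q0 tQ] maxQ]; split=> // x y Ax Ay Qxy.
have /(proper_idealP ringA) [[mQ QA] Q1] := propQ.
have [Qx|nQx] := pselect (Q x); [by left|right].
pose J := [set q + x * a | q in Q & a in A].
have QJ : Q `<=` J.
  move=> q Qq; exists q => //; exists 0; first exact: (subring0 ringA).
  by rewrite mulr0 addr0.
have mJ : submodule A J.
  split; first by apply: QJ; exact: submodule0 mQ.
  move=> a _ _ Aa [q Qq [b Ab <-]] [q' Qq' [b' Ab' <-]].
  exists (a * q + q'); first by case: mQ => _; apply.
  exists (a * b + b'); last by ring.
  by apply: (subringD ringA) => //; apply: (subringM ringA).
have J0 : nonzero J by have [e Qe e0] := Q0; exists e => //; exact: QJ.
have JA : J `<=` A.
  move=> _ [q Qq [b Ab <-]]; apply: (subringD ringA); first exact: QA.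
  exact: (subringM ringA).
have tJ1 : op_t A J 1.
  apply: contrapT => tJ1; have [M tM JM] :=
    exists_t_maximal (conj mJ JA) J0 tJ1.
  have MQ : M = Q by apply: maxQ; [case: tM|exact: subset_trans JM].
  apply: nQx; rewrite -MQ; apply: JM; exists 0; first exact: submodule0 mQ.
  by exists 1; [exact: (subring1 ringA)|rewrite mulr1 add0r].
have [->|y0] := eqVneq y 0; first exact: submodule0 mQ.
have /(op_tP ringA fracA _ mJ) [g [g0 Jg g1]] := tJ1.
rewrite -tQ; apply/(op_tP ringA fracA) => //; exists (y *: g); split.
- by rewrite scaler_eq0 negb_or y0.
- move=> i; rewrite coefZ; have [q Qq [b Ab <-]] := Jg i.
  have -> : y * (q + x * b) = y * q + b * (x * y) by ring.
  by apply: (submoduleD ringA mQ); apply: (submoduleZ mQ).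
apply/(op_v_contP ringA) => z; rewrite scalerA => zyg; rewrite mulrC.
by rewrite -[z * y]mul1r; move/(op_v_contP ringA): g1; apply.
Qed.

Lemma t_maximal_vprim Q g : t_maximal A Q -> vprim A g -> ~ coefs_in Q g.
Proof.
move=> [[/(proper_idealP ringA) [[mQ QA] Q1] Q0 tQ] _] prim_g Qg.
have [g0 Ag _] := prim_g.
apply: Q1; rewrite -tQ; apply/(op_tP ringA fracA) => //; exists g; split=> //.
by have /(vprimP ringA) -> := prim_g => //; exact: (subring1 ringA).
Qed.

(** The d in A with dx in E form an ideal.  It escapes every maximal t-ideal
    exactly when its t-closure is A, that is, when it contains a finitely
    generated ideal with trivial dual. *)
Lemma op_wP E x : submodule A E -> nonzero E ->
  op_w A E x <-> exists2 g, vprim A g & coefs_in E (x *: g).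
Proof.
move=> mE [e Ee e0]; split; last first.
  move=> [g prim_g Eg] Q tQ; have primQ := t_maximal_prime tQ.
  have [_ Ag _] := prim_g.
  apply/mprod_localizationP => //.
  have [i Qgi] : exists i, ~ Q g`_i.
    by apply/existsNP; exact: (t_maximal_vprim tQ).
  by exists g`_i; split=> //; rewrite mulrC -coefZ; apply: Eg.
move=> wx; pose I := A `&` [set d | E (x * d)].
have mI : submodule A I.
  by apply: submoduleI;
    [exact: (submodule_self ringA)|exact: (submodule_preim ringA)].
have IA : I `<=` A by move=> d [].
have I0 : nonzero I.
  have [a [b [Aa Ab b0 ab]]] := fracA (x / e).
  have [c [d [Ac Ad d0 cd]]] := fracA e.
  have ax : x * b = a * e by move/eqP: ab; rewrite eqr_div // => /eqP.
  by exists b => //; split=> //=; rewrite ax; apply: submoduleZ mE Aa Ee.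
have tI1 : op_t A I 1.
  apply: contrapT => tI1; have [Q tQ IQ] :=
    exists_t_maximal (conj mI IA) I0 tI1.
  have primQ := t_maximal_prime tQ.
  have /(mprod_localizationP ringA _ primQ mE) [s [As Qs Esx]] := wx Q tQ.
  by apply: Qs; apply: IQ; split=> //=; rewrite mulrC.
have /(op_tP ringA fracA _ mI) [g [g0 Ig g1]] := tI1.
have Ag : coefs_in A g by move=> i; apply: IA.
exists g; last by move=> i; rewrite coefZ; have [] := Ig i.
by split=> // y yg; rewrite -[y]mul1r; apply: (op_v_contP ringA g 1).1.
Qed.

End TMaximal.

(** * Prufer v-multiplication domains *)

Section PruferV.
Variables (L : fieldType) (A : set L).
Hypothesis ringA : subring A.
Hypothesis fracA : quotient_field A.
Implicit Types (E F G H I J Q : set L) (f g p q y : {poly L}).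

Let mcolon E : submodule A (colon A E).
Proof. by apply: (submodule_colon ringA); exact: (submodule_self ringA). Qed.

Lemma coefs_in_mprodM f g E F : submodule A E ->
  coefs_in E f -> coefs_in F g -> coefs_in (mprod A E F) (f * g).
Proof.
move=> mE Ef Fg i; rewrite coefM; apply: (submodule_sum ringA) => [|j _].
  exact: submodule_span.
exact: mem_mprod.
Qed.

Lemma colon_content_join g y1 y2 :
  coefs_in (colon A (cont A g)) y1 -> coefs_in (colon A (cont A g)) y2 ->
  exists y, [/\ coefs_in (colon A (cont A g)) y,
    cont A (y1 * g) `<=` cont A (y * g) & cont A (y2 * g) `<=` cont A (y * g)].
Proof.
move=> gy1 gy2; pose m := size (y1 * g).
exists (y1 + 'X^m * y2); rewrite mulrDl -mulrA.
have [sub1 sub2 _] := cont_join ringA (y2 * g) (leqnn m); split=> // i.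
rewrite coefD; apply: (submoduleD ringA (mcolon _)); first exact: gy1.
exact: (submodule_coefs_inM ringA (mcolon _) (coefs_inXn ringA m) gy2).
Qed.

Lemma mprod_colon_content g z : mprod A (cont A g) (colon A (cont A g)) z ->
  exists2 y, coefs_in (colon A (cont A g)) y & cont A (y * g) z.
Proof.
rewrite -[X in _ -> X]/([set z | exists2 y, coefs_in (colon A (cont A g)) y &
  cont A (y * g) z] z).
move: z; apply: mprod_sub => [|x u gx gu].
  split; first exists 0.
  - by move=> i; rewrite coef0; exact: submodule0 (mcolon _).
  - exact: submodule0 (submodule_cont A _).
  move=> a z1 z2 Aa [y1 gy1 z1y] [y2 gy2 z2y].
  have [y [gy sub1 sub2]] := colon_content_join gy1 gy2; exists y => //.
  by have [_] := submodule_cont A (y * g); apply=> //;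
    [exact: sub1|exact: sub2].
exists u%:P.
  by move=> i; rewrite coefC; case: ifP => // _; exact: submodule0 (mcolon _).
by rewrite mul_polyC (cont_scale ringA); exists x => //; rewrite mulrC.
Qed.

(** t-invertibility of the ideal c(g) is witnessed by one polynomial y with
    coefficients in the dual of c(g) such that c(yg) has trivial dual: a
    finitely generated subideal of c(g) c(g)^-1 only involves finitely many
    elements of c(g)^-1, and spreading those out as the coefficients of y at
    sufficiently distant exponents keeps the products apart. *)
Lemma PvMD_inverse g : PvMD A -> g != 0 ->
  exists y, vprim A (y * g) /\ forall i, coefs_in A (g`_i *: y).
Proof.
move=> pvmd g0; set F := cont A g.
have mFF : submodule A (mprod A F (colon A F)) by exact: submodule_span.
have : op_t A (mprod A F (colon A F)) 1.
  by rewrite pvmd; [exact: (subring1 ringA)|exact: (fg_frac_ideal_cont ringA fracA)].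
move=> /(op_tP ringA fracA _ mFF) [h [h0 Fh h1]].
have [y [Fy yh]] : exists y, coefs_in (colon A F) y /\
    forall i, (i < size h)%N -> cont A (y * g) h`_i.
  elim: (size h) => [|n [y [Fy yh]]].
    by exists 0; split=> // i; rewrite coef0; exact: submodule0 (mcolon _).
  have [y' Fy' y'h] := mprod_colon_content (Fh n).
  have [z [Fz sub sub']] := colon_content_join Fy Fy'; exists z; split=> // i.
  by rewrite ltnS leq_eqVlt => /predU1P[->|/yh]; [exact: sub'|exact: sub].
have {}yh : coefs_in (cont A (y * g)) h.
  move=> i; have [/yh//|lei] := ltnP i (size h).
  by rewrite nth_default //; exact: submodule0 (submodule_cont A _).
exists y; split; last first.
  by move=> i j; rewrite coefZ mulrC; apply: Fy; exact: mem_cont.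
split.
- apply: contraNneq h0 => yg0; apply/eqP/polyP => i; rewrite coef0.
  by have := yh i; rewrite yg0 => /cont_poly0.
- move=> i; rewrite coefM; apply: (subring_sum ringA) => j _.
  by apply: Fy; exact: mem_cont.
move=> x xyg; rewrite -[x]mul1r; apply: (op_v_contP ringA h 1).1 => // i.
have mx : submodule A [set z | A (x * z)].
  exact: (submodule_preim ringA _ (submodule_self ringA)).
rewrite coefZ; apply: (@cont_sub L A (y * g) [set z | A (x * z)] mx _ _ (yh i)).
by move=> j /=; rewrite -coefZ.
Qed.

Lemma inverse_PvMD :
  (forall g, g != 0 ->
     exists y, vprim A (y * g) /\ forall i, coefs_in A (g`_i *: y)) ->
  PvMD A.
Proof.
move=> inv F /(fg_frac_idealP ringA fracA) [g g0 ->].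
have [y [prim_yg gy]] := inv g g0; have [yg0 Ayg _] := prim_yg.
have gy' : coefs_in (colon A (cont A g)) y.
  move=> i; apply/(colon_contP ringA) => [|j];
    first exact: (submodule_self ringA).
  by rewrite mulrC -coefZ; exact: gy.
have FA := @mprod_self_sub_colon L A ringA (cont A g).
have mFF : submodule A (mprod A (cont A g) (colon A (cont A g))).
  exact: submodule_span.
have F0 : coefs_in (mprod A (cont A g) (colon A (cont A g))) (y * g).
  by rewrite mprodC; apply: coefs_in_mprodM => // i; exact: mem_cont.
apply: ideal_eq; last first.
  apply/(op_tP ringA fracA) => //; exists (y * g); split=> //.
  by have /(vprimP ringA) -> := prim_yg => //; exact: (subring1 ringA).
split; last exact: op_t_sub_ring.
apply: (submodule_op_t ringA fracA) => //.
exists (lead_coef (y * g)); first exact: F0.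
by rewrite lead_coef_eq0.
Qed.

Lemma PvMD_v_domain : PvMD A -> v_domain A.
Proof.
move=> pvmd F fgF; apply: (op_v_eq_ring ringA);
  first exact: (mprod_self_sub_colon ringA).
by apply: op_t_sub_v; rewrite (pvmd F fgF); exact: (subring1 ringA).
Qed.

(** * The associated operations *)

Lemma op_w_sub_t E : frac_ideal A E -> op_w A E `<=` op_t A E.
Proof.
move=> [mE E0 _] x /(op_wP ringA fracA x mE E0) [g prim_g Eg].
have [g0 _ prim] := prim_g.
have [->|x0] := eqVneq x 0.
  exact: submodule0 (submodule_op_t ringA fracA mE E0).
apply/(op_tP ringA fracA) => //; exists (x *: g); split=> //;
  first by rewrite scaler_eq0 negb_or x0.
by apply/(op_v_contP ringA) => // z; rewrite scalerA mulrC => /prim.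
Qed.

Lemma PvMD_eq_w_t : PvMD A -> eq_on_F A (op_w A) (op_t A).
Proof.
move=> pvmd E fE; apply/seteqP; split; first exact: op_w_sub_t.
have [mE E0 _] := fE; move=> x /(op_tP ringA fracA _ mE) [g [g0 Eg xg]].
have [y [prim_yg gy]] := PvMD_inverse pvmd g0.
apply/(op_wP ringA fracA) => //; exists (y * g) => //.
rewrite scalerAl; apply: (submodule_coefs_inM ringA) => // i.
rewrite coefZ; apply: (op_v_contP ringA g x).1 => // j.
by rewrite coefZ mulrC -coefZ; exact: gy.
Qed.

Lemma op_a_eq_on star1 star2 : eq_on_F A star1 star2 ->
  forall E, op_a A star1 E = op_a A star2 E.
Proof.
move=> eq12 E; apply: eq_bigcupr => F [fgF _]; apply: eq_bigcupr => H fgH.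
have [fH _] := fgH; have [fFH _] := fg_frac_ideal_mprod ringA fgF fgH.
by rewrite !eq12.
Qed.

Lemma colon_op_v_closed E F : colon (op_v A E) F `<=` colon (op_v A E) (op_v A F).
Proof.
move=> x xF z zF y yE; have -> : x * z * y = z * (x * y) by ring.
apply: zF => f Ff; have -> : x * y * f = x * f * y by ring.
exact: xF.
Qed.

Lemma op_t_sub_op_a_v E : op_t A E `<=` op_a A (op_v A) E.
Proof.
move=> x [F [fgF FE] xF]; exists F => //; exists A;
  first exact: (fg_frac_ideal_ring ringA fracA).
rewrite mprodC (mprod_ringl ringA); last by case: fgF => [[]].
rewrite op_v_ring => a Aa; rewrite mulrC.
exact: submoduleZ (submodule_op_v ringA F) Aa xF.
Qed.

(** Multiplication by an element y of the dual of F turns the hypothesis on x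
    into xyH contained in H^v, whence xy is in A. *)
Lemma v_domain_cancel F H : v_domain A -> fg_frac_ideal A H ->
  colon (op_v A (mprod A F H)) H `<=` op_v A F.
Proof.
move=> /(v_domainP ringA) vA fgH x xH y yF.
apply: (vA H fgH) => h Hh z zH.
have -> : x * y * h * z = x * h * (y * z) by ring.
apply: (xH h) => // u.
rewrite -[A _]/([set u | A (y * z * u)] u); apply: mprod_sub => /=.
  exact: (submodule_preim ringA _ (submodule_self ringA)).
move=> f h' Ff Hh'; have -> : y * z * (f * h') = y * f * (z * h') by ring.
by apply: (subringM ringA); [exact: yF|exact: zH].
Qed.

Lemma v_domain_op_a_v_sub E : v_domain A -> op_a A (op_v A) E `<=` op_t A E.
Proof.
move=> vA x [F [fgF FE] [H fgH xH]]; exists F => //.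
apply: (v_domain_cancel vA fgH) => h Hh; apply: xH; exact: op_v_ext.
Qed.

Lemma eq_v_t_of_op_a star : eq_on_F A (op_v A) (op_a A star) ->
  eq_on_F A (op_v A) (op_t A).
Proof.
move=> va E fE; apply/seteqP; split; last exact: op_t_sub_v.
rewrite va // => x [F [fgF FE] xF]; exists F => //.
by rewrite va; [exists F => //; split|case: fgF].
Qed.

(** If xF is contained in F^v, then x lies in the associated closure of A,
    with F itself as witness. *)
Lemma v_domain_of_op_a_v :
  eq_on_F A (op_v A) (op_a A (op_v A)) -> v_domain A.
Proof.
move=> va; apply/(v_domainP ringA) => // F fgF x xF.
have fgA := fg_frac_ideal_ring ringA fracA.
suff : op_v A A x by rewrite op_v_ring.
rewrite va; last by case: fgA.
exists A; first by split.
exists F => //; rewrite (mprod_ringl ringA); last by case: fgF => [[]].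
exact: colon_op_v_closed.
Qed.

(** Polynomials with trivial dual multiply, so one of them serves for finitely
    many elements of E^w. *)
Lemma op_w_coefs E h : submodule A E -> nonzero E -> coefs_in (op_w A E) h ->
  exists2 g, vprim A g & forall i, coefs_in E (h`_i *: g).
Proof.
move=> mE E0 Eh.
suff [g prim_g hg] : exists2 g, vprim A g &
    forall i, (i < size h)%N -> coefs_in E (h`_i *: g).
  exists g => // i; have [/hg//|lei] := ltnP i (size h).
  by rewrite nth_default // scale0r => j; rewrite coef0; exact: submodule0 mE.
elim: (size h) => [|n [g prim_g hg]]; first by exists 1 => //;
  exact: (vprim1 ringA).
have [p prim_p hp] := (op_wP ringA fracA h`_n mE E0).1 (Eh n).
have [_ Ag _] := prim_g; have [_ Ap _] := prim_p.
exists (p * g); first exact: (vprimM ringA).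
move=> i; rewrite ltnS leq_eqVlt => /predU1P[->|/hg Ehg].
  by rewrite mulrC scalerAr; apply: (submodule_coefs_inM ringA).
by rewrite scalerAr; apply: (submodule_coefs_inM ringA).
Qed.

(** One polynomial p with trivial dual carries the products of x with all the
    generators of F into F; hence c(p)x consists of elements that multiply F
    into F. *)
Lemma colon_op_w_sub :
  (forall F, fg_frac_ideal A F -> colon F F `<=` A) ->
  forall F, fg_frac_ideal A F -> colon (op_w A F) F `<=` A.
Proof.
move=> closedA F fgF x xF.
have [g g0 defF] := (fg_frac_idealP ringA fracA F).1 fgF.
have [[mF F0 _] _] := fgF.
have [|p prim_p Fp] := @op_w_coefs F (x *: g) mF F0.
  by move=> i; rewrite coefZ; apply: xF; rewrite defF; exact: mem_cont.
have [_ _ prim] := prim_p; apply: prim => j; rewrite coefZ.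
apply: (closedA F fgF); rewrite {2}defF; apply/(colon_contP ringA) => // i.
by have := Fp i j; rewrite !coefZ mulrAC.
Qed.

Lemma op_w_mono E F : E `<=` F -> op_w A E `<=` op_w A F.
Proof.
move=> EF x wx Q tQ; move: (wx Q tQ).
apply: mprod_sub; first exact: submodule_span.
by move=> e y Ee Qy; apply: mem_mprod => //; exact: EF.
Qed.

Lemma submodule_op_w E : submodule A (op_w A E).
Proof.
have mEQ Q : submodule A (mprod A E (localization A Q)) by exact: submodule_span.
split=> [Q tQ|a x y Aa wx wy Q tQ]; first exact: submodule0 (mEQ Q).
by have [_] := mEQ Q; apply; [|exact: wx|exact: wy].
Qed.

(** Enlarging the witness F to FH keeps the relation; this is how finitely many
    witnesses are replaced by a common one. *)
Lemma op_w_mprod_colon E F H x :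
  fg_frac_ideal A E -> fg_frac_ideal A F -> fg_frac_ideal A H ->
  colon (op_w A (mprod A E F)) F x ->
  colon (op_w A (mprod A E (mprod A F H))) (mprod A F H) x.
Proof.
move=> fgE fgF fgH xF.
have [mFH F0 _] := frac_ideal_mprod ringA fgE.1 fgF.1.
have [mFH' F0' _] :=
  frac_ideal_mprod ringA fgE.1 (frac_ideal_mprod ringA fgF.1 fgH.1).
set G := mprod A E (mprod A F H).
have subG (f h : L) : mprod A E F f -> H h -> G (f * h).
  move=> EFf Hh; rewrite mulrC -[G _]/([set f | G (h * f)] f).
  move: f EFf; apply: mprod_sub => [|e f Ee Ff /=].
    exact: (submodule_preim ringA _ mFH').
  by rewrite mulrC -mulrA; do 2 apply: mem_mprod => //.
move=> u; rewrite -[X in _ -> X]/([set u | op_w A G (x * u)] u).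
apply: mprod_sub => [|f h Ff Hh /=].
  exact: (submodule_preim ringA _ (submodule_op_w G)).
have /(op_wP ringA fracA _ mFH F0) [g prim_g Gg] := xF f Ff.
apply/(op_wP ringA fracA) => //; exists g => // i; rewrite coefZ.
have -> : x * (f * h) * g`_i = x * f * g`_i * h by ring.
by apply: subG => //; rewrite -coefZ; exact: Gg.
Qed.

(** When v is the operation associated with w, xF contained in F^v means that
    x c lies in ((FH)^w : H) for each of the generators c of F; a common H then
    gives x(FH) contained in (FH)^w.  On the other hand the elements t with
    tF contained in F belong to the associated closure of A, which is A. *)
Lemma v_domain_of_op_a_w :
  eq_on_F A (op_v A) (op_a A (op_w A)) -> v_domain A.
Proof.
move=> va; have fgA := fg_frac_ideal_ring ringA fracA.
have closedA F : fg_frac_ideal A F -> colon F F `<=` A.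
  move=> fgF x xF; suff : op_v A A x by rewrite op_v_ring.
  have [[mF F0 _] _] := fgF.
  rewrite va; last by case: fgA.
  exists A; first by split.
  exists F => //; rewrite (mprod_ringl ringA) // =>
    z /(op_wP ringA fracA z mF F0).
  move=> [g prim_g Fg]; apply/(op_wP ringA fracA) => //; exists g => // i.
  by rewrite coefZ -mulrA -coefZ; apply: xF; exact: Fg.
apply/(v_domainP ringA) => // F fgF x xF.
have [g g0 defF] := (fg_frac_idealP ringA fracA F).1 fgF.
have [H [fgH xgH]] : exists H, fg_frac_ideal A H /\ forall i, (i < size g)%N ->
    colon (op_w A (mprod A F H)) H (x * g`_i).
  elim: (size g) => [|n [H [fgH xgH]]]; first by exists A.
  have : op_a A (op_w A) F (x * g`_n).
    rewrite -va; last by case: fgF.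
    by apply: xF; rewrite defF; exact: mem_cont.
  move=> [F' [fgF' F'F] [H' fgH' xH']].
  have xgH' : colon (op_w A (mprod A F H')) H' (x * g`_n).
    move=> h Hh; have [[mH' H'0 _] _] := fgH'.
    have : op_w A (mprod A F' H') (x * g`_n * h).
      apply: xH'; apply/(op_wP ringA fracA) => //; exists 1;
        first exact: (vprim1 ringA).
      move=> [|i]; rewrite coefZ coef1 ?mulr1 // mulr0; exact: submodule0 mH'.
    apply: op_w_mono; apply: mprod_sub; first exact: submodule_span.
    by move=> f h' F'f H'h; apply: mem_mprod => //; exact: F'F.
  exists (mprod A H H'); split; first exact: (fg_frac_ideal_mprod ringA).
  move=> i; rewrite ltnS leq_eqVlt => /predU1P[->|/xgH].
    by rewrite (mprodC A H); apply: op_w_mprod_colon.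
  by apply: op_w_mprod_colon.
have fgFH := fg_frac_ideal_mprod ringA fgF fgH.
apply: (colon_op_w_sub closedA fgFH) => u.
rewrite -[X in _ -> X]/([set u | op_w A (mprod A F H) (x * u)] u).
apply: mprod_sub => [|f h Ff Hh /=].
  exact: (submodule_preim ringA _ (submodule_op_w _)).
have mh : submodule A [set f | op_w A (mprod A F H) (x * h * f)].
  exact: (submodule_preim ringA _ (submodule_op_w _)).
rewrite [f * h]mulrC mulrA -[op_w _ _ _]/([set f | op_w A (mprod A F H) (x * h * f)] f).
move: f Ff; rewrite {1}defF; apply: cont_sub => // i /=; rewrite mulrAC.
have [lti|lei] := ltnP i (size g); first exact: xgH.
by rewrite [g`__]nth_default // mulr0 mul0r;
  exact: submodule0 (submodule_op_w _).
Qed.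

Lemma v_domain_eq_op_a_v : v_domain A -> eq_on_F A (op_v A) (op_t A) ->
  eq_on_F A (op_v A) (op_a A (op_v A)).
Proof.
move=> vA vt E fE; apply/seteqP; split.
  by rewrite vt //; exact: op_t_sub_op_a_v.
by rewrite vt //; exact: v_domain_op_a_v_sub.
Qed.

(** * Essential domains *)

(** For Q a maximal t-ideal and F = (1, x), the product of F and its dual is not
    contained in Q, so one of the generators 1, x divides the other one at Q. *)
Lemma PvMD_essential : PvMD A -> essential_domain A.
Proof.
move=> pvmd; exists (t_maximal A); split=> [Q tQ|].
  have primQ := t_maximal_prime ringA fracA tQ; split=> // x x0.
  pose g := Poly [:: 1; x].
  have g0 : g != 0.
    apply/eqP => /polyP /(_ 0%N); rewrite coef_Poly coef0 /=.
    by move/eqP; rewrite oner_eq0.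
  have [y [prim_yg gy]] := PvMD_inverse pvmd g0.
  have Ay i : A y`_i by have := gy 0%N i; rewrite coefZ coef_Poly mul1r.
  have Axy i : A (x * y`_i) by have := gy 1%N i; rewrite coefZ coef_Poly.
  have mQ : submodule A Q by case: primQ => [[[]]].
  have nQ : ~ forall i, Q y`_i /\ Q (x * y`_i).
    move=> Qy; apply: (t_maximal_vprim ringA fracA tQ prim_yg) => i.
    rewrite coefM; apply: (submodule_sum ringA) => // j _; rewrite coef_Poly.
    case: (i - j)%N => [|[|n]] /=; last first.
    - by rewrite nth_nil mulr0; exact: submodule0 mQ.
    - by rewrite mulrC; case: (Qy j).
    - by rewrite mulr1; case: (Qy j).
  have [i /not_andP nQi] := (existsNP _).2 nQ.
  have y0 : y`_i != 0.
    apply: contra_notN nQ => /eqP yi0; exfalso; move: nQi; rewrite yi0 mulr0.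
    by case; apply; exact: submodule0 mQ.
  case: nQi => nQi.
    left; exists (x * y`_i), y`_i; split; [exact: Axy|exact: Ay|by []|].
    by rewrite mulfK.
  right; exists y`_i, (x * y`_i); split; [exact: Ay|exact: Axy|by []|].
  by field; rewrite y0.
have [[mA A0 _] _] := fg_frac_ideal_ring ringA fracA.
apply/seteqP; split=> [a Aa Q tQ|x xQ].
  have [/(proper_idealP ringA) [_ Q1] _] := t_maximal_prime ringA fracA tQ.
  by exists a, 1; split=> //; [exact: (subring1 ringA)|rewrite divr1].
have : op_w A A x.
  move=> Q tQ; have primQ := t_maximal_prime ringA fracA tQ.
  apply/(mprod_localizationP ringA) => //; have [a [s [Aa As Qs ->]]] :=
    xQ Q tQ.
  have s0 : s != 0.
    apply: contra_notN Qs => /eqP ->.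
    by have [[[/submodule0]]] := primQ.
  by exists s; split=> //; rewrite mulrC divfK.
by move=> /(op_wP ringA fracA x mA A0) [g [_ _ prim_g] Ag]; exact: prim_g.
Qed.

(** Among finitely many elements, one divides all the others in a valuation
    domain; s is a common denominator of the quotients. *)
Lemma valuation_content P g : prime_ideal A P ->
  valuation_domain (localization A P) -> g != 0 ->
  exists k s, [/\ g`_k != 0, A s, ~ P s & coefs_in A ((s / g`_k) *: g)].
Proof.
move=> [/(proper_idealP ringA) [[mP PA] P1] primeP] valP g0.
suff [k [s [gk0 As Ps gs]]] : exists k s, [/\ g`_k != 0, A s, ~ P s &
    forall i, (i < size g)%N -> A (s / g`_k * g`_i)].
  exists k, s; split=> // i; rewrite coefZ; have [/gs//|lei] := ltnP i (size g).
  by rewrite [g`_i]nth_default // mulr0; exact: (subring0 ringA).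
have [szg|] : (forall i, (i < size g)%N -> g`_i = 0) \/
    exists k s, [/\ g`_k != 0, A s, ~ P s &
      forall i, (i < size g)%N -> A (s / g`_k * g`_i)]; last by [].
  elim: (size g) => [|n IHn]; first by left.
  have [gn0|gn0] := eqVneq g`_n 0.
    case: IHn => [g_eq0|[k [s [gk0 As Ps gs]]]].
      by left=> i; rewrite ltnS leq_eqVlt => /predU1P[->|/g_eq0].
    right; exists k, s; split=> // i; rewrite ltnS leq_eqVlt.
    by move=> /predU1P[->|/gs//]; rewrite gn0 mulr0; exact: (subring0 ringA).
  right; case: IHn => [g_eq0|[k [s [gk0 As Ps gs]]]].
    exists n, 1; split=> //; first exact: (subring1 ringA).
    move=> i; rewrite ltnS leq_eqVlt => /predU1P[->|/g_eq0 ->].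
      by rewrite divfK //; exact: (subring1 ringA).
    by rewrite mulr0; exact: (subring0 ringA).
  have neP0 t : ~ P t -> t != 0.
    by move=> Pt; apply: contra_notN Pt => /eqP ->; exact: submodule0 mP.
  have PM t t' : A t -> A t' -> ~ P t -> ~ P t' -> ~ P (t * t').
    by move=> At At' Pt Pt' /(primeP _ _ At At') [].
  have quo0 : g`_n / g`_k != 0 by rewrite mulf_neq0 ?invr_eq0.
  have [|] := valP _ quo0; move=> [a [s' [Aa As' Ps' eqq]]];
      have s'0 := neP0 _ Ps'.
    exists k, (s * s'); split=> //; [exact: (subringM ringA)|exact: PM|].
    move=> i; rewrite ltnS leq_eqVlt => /predU1P[->|/gs Agi].
      have -> : s * s' / g`_k * g`_n = s * s' * (g`_n / g`_k) by field.
      have -> : s * s' * (g`_n / g`_k) = s * a by rewrite eqq; field.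
      by apply: (subringM ringA).
    have -> : s * s' / g`_k * g`_i = s' * (s / g`_k * g`_i) by field.
    by apply: (subringM ringA).
  exists n, (s * s'); split=> //; [exact: (subringM ringA)|exact: PM|].
  move=> i; rewrite ltnS leq_eqVlt => /predU1P[->|/gs Agi].
    by rewrite divfK //; exact: (subringM ringA).
  have -> : s * s' / g`_n * g`_i = s' * (g`_n / g`_k)^-1 * (s / g`_k * g`_i).
    by field; rewrite ?gn0 ?gk0.
  rewrite eqq; have -> : s' * (a / s') = a by field.
  by apply: (subringM ringA).
case/eqP: g0; apply/polyP => i; rewrite coef0.
by have [/szg//|lei] := ltnP i (size g); rewrite nth_default.
Qed.

(** If g_k generates F at P, then s/g_k is in the dual of F for some s outside
    P, and xs = (x g_k)(s/g_k) is in A. *)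
Lemma essential_v_domain : essential_domain A -> v_domain A.
Proof.
move=> [S [Sval AS]]; apply/(v_domainP ringA) => // F fgF x xF.
have [g g0 defF] := (fg_frac_idealP ringA fracA F).1 fgF.
rewrite AS => P SP; have [primP valP] := Sval P SP.
have [k [s [gk0 As Ps gs]]] := valuation_content primP valP g0.
have s0 : s != 0.
  apply: contra_notN Ps => /eqP ->.
  by have [[[/submodule0]]] := primP.
exists (x * s), s; split=> //; last by rewrite mulfK.
have -> : x * s = x * g`_k * (s / g`_k) by field.
apply: xF; first by rewrite defF; exact: mem_cont.
rewrite defF; apply/(colon_contP ringA); first exact: (submodule_self ringA).
by move=> i; rewrite -coefZ.
Qed.

End PruferV.

(** * Divisorial Bezout domains *)

Definition principal (L : fieldType) (A : set L) (a : L) : set L :=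
  [set a * b | b in A].

Definition bezout (L : fieldType) (A : set L) : Prop :=
  forall x y : L, exists d, [/\ exists a b, [/\ A a, A b & d = a * x + b * y],
    principal A d x & principal A d y].

Section MaximalIdeals.
Variables (L : fieldType) (A : set L).
Hypothesis ringA : subring A.
Implicit Types (I J M P : set L).

Lemma submodule_principal a : submodule A (principal A a).
Proof.
split; first by exists 0; [exact: (subring0 ringA)|rewrite mulr0].
move=> c _ _ Ac [b Ab <-] [b' Ab' <-]; exists (c * b + b'); last by ring.
by apply: (subringD ringA) => //; apply: (subringM ringA).
Qed.

Lemma mem_principal a : principal A a a.
Proof. by exists 1; [exact: (subring1 ringA)|rewrite mulr1]. Qed.

Lemma ideal_principal a : A a -> ideal A (principal A a).
Proof.
move=> Aa; split=> [|_ [b Ab <-]]; first exact: submodule_principal.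
by apply: (subringM ringA).
Qed.

Lemma fin_gen_of_principal a : fin_gen A (principal A a).
Proof.
exists [:: a]; apply/seteqP; split=> [_ [b Ab <-]|].
  rewrite mulrC; apply: (submoduleZ (@submodule_span L A _) Ab).
  by apply: mem_span; rewrite /= mem_head.
apply: span_sub; first exact: submodule_principal.
by move=> x /=; rewrite inE => /eqP ->; exact: mem_principal.
Qed.

Lemma exists_maximal_ideal I : proper_ideal A I ->
  exists2 M, maximal_ideal A M & I `<=` M.
Proof.
move=> propI.
have [C C0 Cprop totC|M [propM IM maxM]] :=
  exists_maximal_above (good := proper_ideal A) propI; last by exists M.
exact: (ideal_chain ringA).
Qed.

Lemma maximal_prime M : maximal_ideal A M -> prime_ideal A M.
Proof.
move=> [propM maxM]; split=> // x y Ax Ay Mxy.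
have /(proper_idealP ringA) [[mM MA] M1] := propM.
have [Mx|nMx] := pselect (M x); [by left|right].
pose J := [set q + x * a | q in M & a in A].
have MJ : M `<=` J.
  move=> q Mq; exists q => //; exists 0; first exact: (subring0 ringA).
  by rewrite mulr0 addr0.
have idJ : ideal A J.
  split=> [|_ [q Mq [b Ab <-]]]; last first.
    by apply: (subringD ringA); [exact: MA|exact: (subringM ringA)].
  split; first by apply: MJ; exact: submodule0 mM.
  move=> a _ _ Aa [q Mq [b Ab <-]] [q' Mq' [b' Ab' <-]].
  exists (a * q + q'); first by case: mM => _; apply.
  exists (a * b + b'); last by ring.
  by apply: (subringD ringA) => //; apply: (subringM ringA).
have Jx : J x.
  exists 0; first exact: submodule0 mM.
  by exists 1; [exact: (subring1 ringA)|rewrite mulr1 add0r].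
have [[q Mq [b Ab qb1]]|J1] := pselect (J 1).
  have -> : y = y * q + b * (x * y).
    by rewrite -[LHS]mulr1 -qb1; ring.
  by apply: (submoduleD ringA) => //; apply: (submoduleZ mM).
case: nMx; rewrite -(maxM J) //; exact/(proper_idealP ringA).
Qed.

Lemma ideal_not_in_maximal I : ideal A I ->
  (forall M, maximal_ideal A M -> exists2 s, I s & ~ M s) -> I 1.
Proof.
move=> idI escape; apply: contrapT => I1.
have [|M maxM IM] := @exists_maximal_ideal I; first exact/(proper_idealP ringA).
by have [s Is] := escape M maxM; apply; exact: IM.
Qed.

End MaximalIdeals.

(** Two distinct maximal ideals M, M' are separated over x when the
    localizations of A at both of them generate a ring in which x becomes a
    unit, that is, some s outside M and t outside M' have st in xA.  This is
    the concrete form of h-locality that divisoriality produces. *)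
Definition separated_maximals (L : fieldType) (A : set L) : Prop :=
  forall M M' x, maximal_ideal A M -> maximal_ideal A M' -> M <> M' ->
    A x -> x != 0 ->
    exists s t, [/\ A s, A t, ~ M s, ~ M' t & principal A x (s * t)].

(** The contraction to A of the localization at M of the ideal xA. *)
Definition local_part (L : fieldType) (A M : set L) (x : L) : set L :=
  [set y | A y /\ exists s, [/\ A s, ~ M s & principal A x (s * y)]].

Section Bezout.
Variables (L : fieldType) (A : set L).
Hypothesis ringA : subring A.
Hypothesis bezA : bezout A.
Implicit Types (I J M P : set L).

Lemma ideal_local_part M x : maximal_ideal A M -> A x ->
  ideal A (local_part A M x).
Proof.
move=> maxM Ax; have [propM primeM] := maximal_prime ringA maxM.
have /(proper_idealP ringA) [_ M1] := propM.
have [mx _] := ideal_principal ringA Ax.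
split=> [|y []//]; split.
  split; first exact: (subring0 ringA).
  exists 1; split=> //; first exact: (subring1 ringA).
  by rewrite mulr0; exact: submodule0 mx.
move=> a y z Aa [Ay [s [As Ms xsy]]] [Az [s' [As' Ms' xsz]]]; split.
  by apply: (subringD ringA) => //; apply: (subringM ringA).
exists (s * s'); split;
  [by apply: (subringM ringA)|by move=> /(primeM _ _ As As') []|].
have -> : s * s' * (a * y + z) = s' * a * (s * y) + s * (s' * z) by ring.
by apply: (submoduleD ringA) => //; apply: (submoduleZ mx) => //;
  apply: (subringM ringA).
Qed.

Lemma local_part_self M x : maximal_ideal A M -> A x -> local_part A M x x.
Proof.
move=> [/(proper_idealP ringA) [_ M1] _] Ax; split=> //.
exists 1; split=> //; first exact: (subring1 ringA).
by exists 1; [exact: (subring1 ringA)|rewrite mulr1 mul1r].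
Qed.

Lemma fin_gen_principal M : fin_gen A M -> exists a, M = principal A a.
Proof.
move=> [s ->]; elim: s => [|x s [a IHs]].
  exists 0; apply/seteqP; split.
    by apply: span_sub => //; exact: (submodule_principal ringA).
  by move=> _ [b Ab <-]; rewrite mul0r;
    exact: (submodule0 (@submodule_span L A _)).
have [d [[b [c [Ab Ac dE]]] [x' Ax' xE] [a' Aa' aE]]] := bezA x a.
have mspan := @submodule_span L A [set` x :: s].
have mpd := submodule_principal ringA d.
exists d; apply/seteqP; split.
  apply: span_sub => // y /=; rewrite inE => /predU1P[->|ys].
    by rewrite -xE; exists x'.
  have : span A [set` s] y by exact: mem_span.
  by rewrite IHs => -[e Ae <-]; rewrite -aE; exists (a' * e);
    [exact: (subringM ringA)|ring].
move=> _ [e Ae <-]; rewrite mulrC; apply: (submoduleZ mspan) => //.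
rewrite dE; apply: (submoduleD ringA mspan); apply: (submoduleZ mspan) => //.
  by apply: mem_span; rewrite /= mem_head.
have : span A [set` s] a.
  by rewrite IHs; exists 1; [exact: (subring1 ringA)|rewrite mulr1].
apply: span_le => y /= ys; apply: mem_span; by rewrite /= inE ys orbT.
Qed.

(** A maximal ideal M is divisorial, so some u outside A multiplies it into A.
    If (1, u) = wA, then 1/w is a nonunit of A and M lies inside the proper
    ideal generated by 1/w. *)
Lemma divisorial_maximal_principal M : divisorial_domain A ->
  maximal_ideal A M -> exists a, M = principal A a.
Proof.
move=> divA [/(proper_idealP ringA) [idM M1] maxM].
have [[m Mm m0]|M0] := pselect (nonzero M); last first.
  exists 0; apply/seteqP; split=> [m Mm|_ [b _ <-]]; last first.
    by rewrite mul0r; case: idM => /submodule0.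
  exists 0; first exact: (subring0 ringA).
  rewrite mulr0; apply/eqP; rewrite eq_sym.
  by apply: contra_notT M0 => m0; exists m.
have [u [uM nAu]] : exists u, colon A M u /\ ~ A u.
  apply: contrapT => noM; apply: M1; rewrite -(divA M idM); last by exists m.
  move=> u uM; rewrite mul1r; apply: contrapT => nAu; by apply: noM; exists u.
have [w [[b [c [Ab Ac wE]]] [w' Aw' ww'] [u' Au' uE]]] := bezA 1 u.
have w0 : w != 0.
  by apply: contra_eqN ww' => /eqP ->; rewrite mul0r eq_sym oner_eq0.
exists w'; symmetry; apply: maxM.
  apply/(proper_idealP ringA) => //; split; first exact: ideal_principal.
  move=> [v Av w'v]; apply: nAu; rewrite -uE.
  have -> : w = v by rewrite -[v]mul1r -ww' -mulrA w'v mulr1.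
  exact: (subringM ringA).
move=> x Mx; have Awx : A (w * x).
  rewrite wE mulrDl mulr1; apply: (subringD ringA).
    by apply: (subringM ringA) => //; case: idM => _; apply.
  by rewrite -mulrA; apply: (subringM ringA) => //; exact: uM.
by exists (w * x) => //; rewrite mulrA [w' * w]mulrC ww' mul1r.
Qed.

(** Suppose the maximal ideals aA and bA are not separated over x.  Then x/a
    multiplies the dual of the local part I of x at aA into A: if u is in that
    dual and q = ux escapes aA, write x = x'd, q = q'd with x', q' comaximal;
    here b divides x', so x/(db) lies in I, whereas u x/(db) = q'/b does not
    lie in A.  As I is divisorial, x/a is in I, forcing a unit at aA. *)
Lemma divisorial_separated : divisorial_domain A -> separated_maximals A.
Proof.
move=> divA M M' x maxM maxM' neqM Ax x0; apply: contrapT => nsep.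
have {}nsep s t : A s -> A t -> ~ M s -> principal A x (s * t) -> M' t.
  by move=> As At Ms xst; apply: contrapT => M't; apply: nsep; exists s, t.
have [a Ma] := divisorial_maximal_principal divA maxM.
have [b M'b] := divisorial_maximal_principal divA maxM'.
have [propM primeM] := maximal_prime ringA maxM.
have /(proper_idealP ringA) [[mM MA] M1] := propM.
have [propM' _] := maxM'.
have /(proper_idealP ringA) [[mM' M'A] M'1] := propM'.
have Mmem c : A c -> M (a * c) by move=> Ac; rewrite Ma; exists c.
have M'mem c : A c -> M' (b * c) by move=> Ac; rewrite M'b; exists c.
have A1 : A 1 by exact: (subring1 ringA).
have Aa : A a by apply: MA; rewrite -[a]mulr1; exact: Mmem.
have Ab : A b by apply: M'A; rewrite -[b]mulr1; exact: M'mem.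
have a0 : a != 0.
  apply: contra_not_neq neqM => a0; symmetry; have [_] := maxM; apply=> //.
  by rewrite Ma a0 => _ [c _ <-]; rewrite mul0r; exact: submodule0 mM'.
have b0 : b != 0.
  apply: contra_not_neq neqM => b0; have [_] := maxM'; apply=> //.
  by rewrite M'b b0 => _ [c _ <-]; rewrite mul0r; exact: submodule0 mM.
have nMb : ~ M b.
  move=> Mb; apply: neqM; have [_] := maxM'; apply=> //.
  by rewrite M'b => _ [c Ac <-]; rewrite mulrC; exact: submoduleZ mM Ac Mb.
set I := local_part A M x.
have idI : ideal A I by exact: ideal_local_part.
have Ix : I x by exact: local_part_self.
have : op_v A I (x / a).
  move=> u uI; have Aq := uI x Ix; set q := u * x in Aq *.
  suff : M q.
    rewrite Ma => -[c Ac acq].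
    have -> : x / a * u = q / a by rewrite /q; ring.
    by rewrite -acq mulrAC mulfV // mul1r.
  apply: contrapT => nMq.
  have [d [[al [be [Aal Abe dE]]] [x' Ax' xE] [q' Aq' qE]]] := bezA x q.
  have d0 : d != 0 by apply: contra_neq x0 => d0; rewrite -xE d0 mul0r.
  have Ad : A d by rewrite dE; apply: (subringD ringA); apply: (subringM ringA).
  have nMd : ~ M d.
    by move=> Md; apply: nMq; rewrite -qE mulrC; exact: submoduleZ mM Aq' Md.
  have M'x' : M' x'.
    by apply: (nsep d) => //; rewrite xE; exists 1; rewrite ?mulr1.
  have nM'q' : ~ M' q'.
    move=> M'q'; apply: M'1.
    have -> : 1 = al * x' + be * q'.
      apply: (mulfI d0); rewrite mulr1 {1}dE -{1}xE -{1}qE; ring.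
    by apply: (submoduleD ringA) => //; apply: (submoduleZ mM').
  move: M'x'; rewrite M'b => -[x'' Ax'' x''E].
  have Ix'' : I x''.
    split=> //; exists (d * b); split; first exact: (subringM ringA).
      by move=> /(primeM _ _ Ad Ab) [].
    by exists 1 => //; rewrite mulr1 -xE -x''E mulrA.
  apply: nM'q'; have -> : q' = b * (u * x'').
    apply: (mulfI d0); rewrite qE /q -xE -x''E; ring.
  by apply: M'mem; exact: uI.
rewrite divA //; last by exists x.
move=> [_ [s [As Ms [c Ac xc]]]]; apply: Ms.
have -> : s = a * c.
  apply: (mulfI x0); rewrite [x * (a * c)]mulrCA xc.
  by field.
exact: Mmem.
Qed.

(** The dual of J = sum of the ideals x(A : I_M), over the maximal ideals M
    containing x, with I_M the local part of x at M, is the intersection of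
    the I_M divided by x, which is A.  Hence J = A.  But an element of J is a
    multiple of x locally at all but finitely many of the M. *)
Lemma divisorial_finite_character x : divisorial_domain A -> A x -> x != 0 ->
  finite_set [set M | maximal_ideal A M /\ M x].
Proof.
move=> divA Ax x0; have sep := divisorial_separated divA.
have A1 : A 1 by exact: (subring1 ringA).
pose G := [set x] `|` [set z | exists M v,
  [/\ maximal_ideal A M, M x, colon A (local_part A M x) v & z = x * v]].
have mJ : submodule A (span A G) by exact: submodule_span.
have JA : span A G `<=` A.
  apply: span_sub; first exact: (submodule_self ringA).
  move=> _ [->//|[M [v [maxM Mx vM ->]]]]; rewrite mulrC; apply: vM.
  exact: local_part_self.
have Jx : span A G x by apply: mem_span; left.
have J1 : span A G 1.
  rewrite -[span A G]divA //; last by exists x.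
  move=> u uJ; rewrite mul1r.
  have Aux : A (u * x) by exact: uJ.
  have idD : ideal A (A `&` [set c | A (u * c)]).
    split=> [|c []//]; apply: submoduleI; first exact: (submodule_self ringA).
    exact: (submodule_preim ringA _ (submodule_self ringA)).
  have [] := ideal_not_in_maximal ringA idD; last by rewrite /= mulr1.
  move=> M maxM; have [Mx|nMx] := pselect (M x); last by exists x.
  have : local_part A M x (u * x).
    have <- : op_v A (local_part A M x) = local_part A M x.
      apply: divA; first exact: ideal_local_part.
      by exists x => //; exact: local_part_self.
    move=> v vM; rewrite -mulrA; apply: uJ; apply: mem_span; right.
    by exists M, v.
  move=> [_ [s [As Ms [c Ac xc]]]]; exists s => //; split=> //=.
  have -> : u * s = c by apply: (mulfI x0); rewrite xc; ring.
  by [].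
(* z is locally a multiple of x at all but finitely many of the M *)
pose almost z := exists F : set (set L), finite_set F /\
    forall M, maximal_ideal A M -> M x -> ~ F M ->
      exists y, [/\ A y, ~ M y & principal A x (y * z)].
have [F [finF FP]] : almost 1.
  suff : span A G `<=` almost by apply.
  apply: span_sub => [|_ [->|[M [v [maxM Mx vM ->]]]]].
  - split.
      exists set0; split; first exact: finite_set0.
      move=> M [/(proper_idealP ringA) [_ M1] _] _ _; exists 1; split=> //.
      by exists 0; [exact: (subring0 ringA)|rewrite !mulr0].
    move=> a z z' Aa [F [finF FP]] [F' [finF' FP']].
    exists (F `|` F'); split; first by rewrite finite_setU.
    move=> M maxM Mx /not_orP [nF nF'].
    have [y [Ay nMy [c Ac xc]]] := FP M maxM Mx nF.
    have [y' [Ay' nMy' [c' Ac' xc']]] := FP' M maxM Mx nF'.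
    have [_ primeM] := maximal_prime ringA maxM.
    exists (y * y'); split;
      [by apply: (subringM ringA)|by move=> /(primeM _ _ Ay Ay') []|].
    exists (a * y' * c + y * c').
      by apply: (subringD ringA); do ?apply: (subringM ringA).
    have -> : x * (a * y' * c + y * c') = a * y' * (x * c) + y * (x * c') by ring.
    by rewrite xc xc'; ring.
  - exists set0; split; first exact: finite_set0.
    move=> M [/(proper_idealP ringA) [_ M1] _] _ _; exists 1; split=> //.
    by exists 1 => //; rewrite mulr1 mul1r.
  exists [set M]; split; first exact: finite_set1.
  move=> M' maxM' M'x neqM.
  have [|s [t [As At Ms M't xst]]] := sep M M' x maxM maxM' _ Ax x0.
    by move=> eqM; apply: neqM.
  exists t; split=> //; exists (v * t); last by ring.
  by apply: vM; split=> //; exists s.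
apply: sub_finite_set finF => M [maxM Mx]; apply: contrapT => nFM.
have [y [Ay nMy]] := FP M maxM Mx nFM; rewrite mulr1 => -[c Ac xcy].
have [/(proper_idealP ringA) [[mM _] _] _] := maxM.
by apply: nMy; rewrite -xcy mulrC; exact: submoduleZ mM Ac Mx.
Qed.

Lemma divisorial_h_local : divisorial_domain A -> h_local A.
Proof.
move=> divA; split=> [I [mI IA] [x Ix x0]|P primeP [x Px x0]].
  apply: sub_finite_set (divisorial_finite_character divA (IA x Ix) x0).
  by move=> M [maxM IM]; split=> //; exact: IM.
have [propP Pmul] := primeP; have [[mP PA] _] := propP.
have [M maxM PM] := exists_maximal_ideal ringA propP.
exists M; split=> // M' [maxM' PM']; apply: contrapT => neqM.
have [s [t [As At Ms M't [c Ac xc]]]] :=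
  divisorial_separated divA maxM maxM' neqM (PA x Px) x0.
have Pst : P (s * t) by rewrite -xc mulrC; exact: submoduleZ mP Ac Px.
by have [/PM|/PM'] := Pmul s t As At Pst.
Qed.

(** In a Bezout domain the elements dividing no product st, with s outside M
    and t outside M', form a prime ideal contained in both M and M', namely
    the contraction of the maximal ideal of the valuation ring generated by
    the localizations at M and at M'. *)
Lemma h_local_separated : h_local A -> separated_maximals A.
Proof.
move=> [_ uniqM] M M' x maxM maxM' neqM Ax x0; apply: contrapT => nsep.
pose P := [set y | A y /\ forall s t, A s -> A t -> ~ M s -> ~ M' t ->
  ~ principal A y (s * t)].
have [/(proper_idealP ringA) [[mM MA] M1] primeM] := maximal_prime ringA maxM.
have [/(proper_idealP ringA) [[mM' M'A] M'1] primeM'] :=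
  maximal_prime ringA maxM'.
have A1 : A 1 by exact: (subring1 ringA).
have Px : P x.
  by split=> // s t As At Ms M't xst; apply: nsep; exists s, t.
have P0 : P 0.
  split; first exact: (subring0 ringA).
  move=> s t As At Ms M't [c _]; rewrite mul0r => /esym/eqP.
  rewrite mulf_eq0 => /orP[]/eqP e0.
    by apply: Ms; rewrite e0; exact: submodule0 mM.
  by apply: M't; rewrite e0; exact: submodule0 mM'.
have PD y z : P y -> P z -> P (y + z).
  move=> [Ay nPy] [Az nPz]; split; first exact: (subringD ringA).
  move=> s t As At Ms M't [c Ac yzc].
  have [d [[al [be [Aal Abe dE]]] [y' Ay' yE] [z' Az' zE]]] := bezA y z.
  have d0 : d != 0.
    apply/eqP => d0; have [_ /(_ s t As At Ms M't)] := P0; apply.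
    by exists c => //; rewrite -yzc -yE -zE d0 !mul0r addr0 mul0r.
  have yz'1 : 1 = al * y' + be * z'.
    by apply: (mulfI d0); rewrite mulr1 {1}dE -{1}yE -{1}zE; ring.
  have PM e : A e -> ~ M e -> ~ M (e * s).
    by move=> Ae Me /(primeM _ _ Ae As) [].
  have [My'|nMy'] := pselect (M y').
    have nMz' : ~ M z'.
      move=> Mz'; apply: M1; rewrite yz'1.
      by apply: (submoduleD ringA) => //; apply: (submoduleZ mM).
    apply: (nPz (z' * s) t) => //; [exact: (subringM ringA)|exact: PM|].
    exists ((y' + z') * c); first by apply: (subringM ringA) => //;
      exact: (subringD ringA).
    by rewrite -mulrA -yzc -yE -zE; ring.
  apply: (nPy (y' * s) t) => //; [exact: (subringM ringA)|exact: PM|].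
  exists ((y' + z') * c); first by apply: (subringM ringA) => //;
    exact: (subringD ringA).
  by rewrite -mulrA -yzc -yE -zE; ring.
have PZ a y : A a -> P y -> P (a * y).
  move=> Aa [Ay nPy]; split; first exact: (subringM ringA).
  move=> s t As At Ms M't [c Ac ayc]; apply: (nPy s t) => //.
  by exists (a * c); [exact: (subringM ringA)|rewrite -ayc; ring].
have primeP : prime_ideal A P.
  split.
    apply/(proper_idealP ringA) => //; split.
      split=> [|y []//]; split=> // a y z Aa Py Pz.
      by apply: PD => //; exact: PZ.
    move=> [_ /(_ 1 1 A1 A1 M1 M'1)]; apply.
    by exists 1; rewrite ?mulr1.
  move=> y z Ay Az [_ nPyz].
  apply: contrapT => /not_orP [nPy nPz].
  have split_out u : A u -> ~ P u ->
      exists s t, [/\ A s, A t, ~ M s, ~ M' t & principal A u (s * t)].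
    move=> Au nPu; apply: contrapT => nst; apply: nPu; split=> //.
    by move=> s t As At Ms M't ust; apply: nst; exists s, t.
  have [s [t [As At Ms M't [c Ac yc]]]] := split_out y Ay nPy.
  have [s' [t' [As' At' Ms' M't' [c' Ac' zc]]]] := split_out z Az nPz.
  apply: (nPyz (s * s') (t * t')); do ?exact: (subringM ringA).
  - by move=> /(primeM _ _ As As') [].
  - by move=> /(primeM' _ _ At At') [].
  exists (c * c'); first exact: (subringM ringA).
  by rewrite mulrACA yc zc; ring.
have PM : P `<=` M.
  move=> y [Ay nPy]; apply: contrapT => My; apply: (nPy y 1) => //.
  by exists 1.
have PM' : P `<=` M'.
  move=> y [Ay nPy]; apply: contrapT => My; apply: (nPy 1 y) => //.
  by exists 1 => //; rewrite mulrC.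
have [|N [_ uniqN]] := uniqM P primeP; first by exists x.
by apply: neqM; rewrite -(uniqN M) // -(uniqN M').
Qed.

(** If z is not in J, the elements carrying z into J lie in some maximal ideal
    aA, and all of J is divisible by za locally at aA.  Separation, applied to the
    finitely many other maximal ideals that contain za, provides t0 outside
    aA divisible by za locally elsewhere, so t0/(za) is in the dual of J.
    It does not multiply z into A. *)
Lemma h_local_divisorial : h_local A ->
  (forall M, maximal_ideal A M -> exists a, M = principal A a) ->
  divisorial_domain A.
Proof.
move=> hlocA princ J [mJ JA] [j0 Jj0 j00].
have sep := h_local_separated hlocA; have [finA _] := hlocA.
have A1 : A 1 by exact: (subring1 ringA).
apply/seteqP; split; last exact: op_v_ext.
move=> z vz; apply: contrapT => nJz.
have Az : A z by rewrite -(op_v_ring A); apply: op_v_mono vz.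
have z0 : z != 0 by apply: contra_notN nJz => /eqP ->; exact: submodule0 mJ.
have propD : proper_ideal A (A `&` [set d | J (z * d)]).
  apply/(proper_idealP ringA) => //; split; last by rewrite /= mulr1 => -[].
  split=> [|d []//]; apply: submoduleI; first exact: (submodule_self ringA).
  exact: (submodule_preim ringA _ mJ).
have [M maxM DM] := exists_maximal_ideal ringA propD.
have [a Ma] := princ M maxM.
have [/(proper_idealP ringA) [[mM MA] M1] primeM] := maximal_prime ringA maxM.
have Aa : A a by apply: MA; rewrite Ma; exists 1; rewrite ?mulr1.
have a0 : a != 0.
  apply: contra_neq j00 => a0.
  have : M j0 by apply: DM; split; [exact: JA|exact: submoduleZ mJ Az Jj0].
  by rewrite Ma a0 => -[c _ <-]; rewrite mul0r.
have za0 : z * a != 0 by rewrite mulf_neq0.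
have Aza : A (z * a) by exact: (subringM ringA).
have [mza _] := ideal_principal ringA Aza.
(* at M = aA, every element of J is divisible by za *)
have locM j : J j -> exists s, [/\ A s, ~ M s & principal A (z * a) (s * j)].
  move=> Jj.
  have [d [[al [be [Aal Abe dE]]] [j' Aj' jE] [z' Az' zE]]] := bezA j z.
  have d0 : d != 0 by apply: contra_neq z0 => d0; rewrite -zE d0 mul0r.
  have Mj' : M j'.
    apply: DM; split=> //=; have -> : z * j' = z' * j by rewrite -jE -zE; ring.
    exact: submoduleZ mJ Az' Jj.
  exists z'; split=> //.
    move=> Mz'; apply: M1; have -> : 1 = al * j' + be * z'.
      by apply: (mulfI d0); rewrite mulr1 {1}dE -{1}jE -{1}zE; ring.
    by apply: (submoduleD ringA) => //; apply: (submoduleZ mM).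
  move: Mj'; rewrite Ma => -[c Ac acj]; exists c => //.
  by rewrite -jE -zE -acj; ring.
have [t0 [At0 nMt0 t0P]] : exists t0, [/\ A t0, ~ M t0 &
    forall M', maximal_ideal A M' /\ principal A (z * a) `<=` M' -> M' <> M ->
      exists t, [/\ A t, ~ M' t & principal A (z * a) (t * t0)]].
  have /finite_seqP [ms msE] : finite_set [set M' | maximal_ideal A M' /\
      principal A (z * a) `<=` M'].
    apply: finA; first exact: ideal_principal.
    by exists (z * a) => //; exists 1; rewrite ?mulr1.
  have maxms M' : M' \in ms -> maximal_ideal A M'.
    move=> msM'; have : [set` ms] M' by [].
    by rewrite -msE => -[].
  suff [t0 [At0 nMt0 t0P]] : exists t0, [/\ A t0, ~ M t0 &
      forall M', M' \in ms -> M' <> M ->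
      exists t, [/\ A t, ~ M' t & principal A (z * a) (t * t0)]].
    exists t0; split=> // M' M'za; apply: t0P.
    by have : [set M' | maximal_ideal A M' /\ principal A (z * a) `<=` M'] M' by [];
      rewrite msE.
  move: maxms {msE}; elim: ms => [|M' ms IHms] maxms; first by exists 1;
    split=> //.
  have [|t0 [At0 nMt0 t0P]] := IHms.
    by move=> M'' msM''; apply: maxms; rewrite inE msM'' orbT.
  have [eqM|neqM] := pselect (M' = M).
    exists t0; split=> // M''; rewrite inE => /predU1P[->|];
      first by move=> /(_ eqM).
    exact: t0P.
  have maxM' : maximal_ideal A M' by apply: maxms; rewrite mem_head.
  have [|s [t [As At Ms M't zast]]] := sep M M' (z * a) maxM maxM' _ Aza za0.
    by move=> eqM; apply: neqM.
  exists (s * t0); split;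
    [by apply: (subringM ringA)|by move=> /(primeM _ _ As At0) []|].
  move=> M''; rewrite inE => /predU1P[-> _|msM'' neqM''].
    exists t; split=> //; have -> : t * (s * t0) = t0 * (s * t) by ring.
    exact: submoduleZ mza At0 zast.
  have [t' [At' M''t' zat']] := t0P M'' msM'' neqM''.
  by exists t'; split=> //; rewrite mulrCA; exact: submoduleZ mza As zat'.
have dualJ j : J j -> principal A (z * a) (t0 * j).
  move=> Jj; have Aj : A j by exact: JA.
  have idC : ideal A (A `&` [set c | principal A (z * a) (t0 * j * c)]).
    split=> [|c []//]; apply: submoduleI; first exact: (submodule_self ringA).
    exact: (submodule_preim ringA _ mza).
  have [] := ideal_not_in_maximal ringA idC; last by rewrite /= mulr1.
  move=> M' maxM'; have [->|neqM] := pselect (M' = M).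
    have [s [As Ms zasj]] := locM j Jj; exists s => //; split=> //=.
    by rewrite -mulrA [j * s]mulrC; exact: submoduleZ mza At0 zasj.
  have [zaM'|nzaM'] := pselect (principal A (z * a) `<=` M').
    have [t [At M't zat]] := t0P M' (conj maxM' zaM') neqM.
    exists t => //; split=> //=.
    have -> : t0 * j * t = j * (t * t0) by ring.
    exact: submoduleZ mza Aj zat.
  exists (z * a); last first.
    have [/(proper_idealP ringA) [[mM' _] _] _] := maxM'.
    move=> M'za; apply: nzaM' => _ [c Ac <-]; rewrite mulrC.
    exact: submoduleZ mM' Ac M'za.
  by split=> //=; exists (t0 * j); [exact: (subringM ringA)|rewrite mulrC].
have : A (z * (t0 / (z * a))).
  apply: vz => j Jj; have [c Ac zac] := dualJ j Jj.
  have -> : t0 / (z * a) * j = t0 * j / (z * a) by ring.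
  by rewrite -zac mulrAC mulfV // mul1r.
move=> At0a; apply: nMt0; rewrite Ma; exists (z * (t0 / (z * a))) => //.
by field; rewrite a0.
Qed.

End Bezout.

(** * Nagata and Kronecker function rings *)

Section FractionNumden.
Import generic_quotient.
Local Open Scope quotient_scope.

Lemma fractionP (R : idomainType) (z : {fraction R}) :
  exists a b : R, b != 0 /\ z = tofrac a / tofrac b.
Proof.
have d0 := denom_ratioP (repr z).
exists (frac (repr z)).1, (frac (repr z)).2; split=> //.
apply: canRL (mulfK _) _; first by rewrite tofrac_eq0.
rewrite -[X in X * _]reprK; unlock tofrac.
rewrite -[LHS]FracField.pi_mul; apply/eqmodP.
rewrite /= FracField.equivfE /FracField.mulf !numden_Ratio ?oner_eq0 ?mulr1 //.
by rewrite mulrC.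
Qed.

End FractionNumden.

Section FunctionRings.
Variables (K : fieldType) (A : set K).
Hypothesis ringA : subring A.
Hypothesis fracA : quotient_field A.
Implicit Types (E F G H I J : set K) (f g h p q y : {poly K}).

(* phi embeds K[X] in its quotient field L *)
Variables (L : fieldType) (phi : {rmorphism {poly K} -> L}).
Hypothesis phi_inj : injective phi.
Hypothesis phi_frac : forall z : L, exists p q, q != 0 /\ z = phi p / phi q.

Let phi_eq0 p : (phi p == 0) = (p == 0).
Proof. by rewrite -(inj_eq phi_inj) rmorph0. Qed.

Definition nagata : set L :=
  [set z | exists f g, [/\ coefs_in A f, vprim A g & z = phi f / phi g]].

Definition kronecker : set L :=
  [set z | exists f g, [/\ coefs_in A f, coefs_in A g, g != 0,
     exists h, [/\ h != 0, coefs_in A h &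
       mprod A (cont A f) (cont A h) `<=`
       op_v A (mprod A (cont A g) (cont A h))]
     & z = phi f / phi g]].

Local Notation N := nagata.

Lemma nagata_poly f : N (phi f) <-> coefs_in A f.
Proof.
split=> [[p [g [Ap prim_g fpg]]]|Af]; last first.
  by exists f, 1; split=> //; [exact: (vprim1 ringA)|rewrite rmorph1 divr1].
have [g0 _ _] := prim_g; apply: (vprim_gauss ringA prim_g).
suff -> : f * g = p by [].
by apply/eqP; rewrite -(inj_eq phi_inj) rmorphM fpg divfK // phi_eq0.
Qed.

Lemma nagata_const x : N (phi x%:P) <-> A x.
Proof.
rewrite nagata_poly; split=> [/(_ 0%N)|Ax]; first by rewrite coefC.
exact: (coefs_inC ringA).
Qed.

Lemma nagata_inv g : vprim A g -> N (phi g)^-1.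
Proof.
by move=> prim_g; exists 1, g; split=> //;
  [exact: (coefs_in1 ringA)|rewrite rmorph1 div1r].
Qed.

Lemma subring_nagata : subring N.
Proof.
split.
- by rewrite -(rmorph1 phi); apply/nagata_poly; exact: (coefs_in1 ringA).
- move=> _ _ [f [g [Af prim_g ->]]] [f' [g' [Af' prim_g' ->]]].
  have [g0 Ag _] := prim_g; have [g'0 Ag' _] := prim_g'.
  exists (f * g' - f' * g), (g * g'); split; [|exact: (vprimM ringA)|].
    by apply: (coefs_inB ringA); apply: (coefs_inM ringA).
  rewrite rmorphB !rmorphM; field.
  by rewrite !phi_eq0 g0 g'0.
move=> _ _ [f [g [Af prim_g ->]]] [f' [g' [Af' prim_g' ->]]].
have [g0 Ag _] := prim_g; have [g'0 Ag' _] := prim_g'.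
exists (f * f'), (g * g'); split;
  [exact: (coefs_inM ringA)|exact: (vprimM ringA)|].
rewrite !rmorphM; field.
by rewrite !phi_eq0 ?g0 ?g'0 ?y0.
Qed.

Lemma integral_fraction (z : L) :
  exists f g, [/\ coefs_in A f, coefs_in A g, g != 0 & z = phi f / phi g].
Proof.
have [p [q [q0 ->]]] := phi_frac z.
have [d [Ad d0 dp]] := common_denominator ringA fracA p.
have [e [Ae e0 eq]] := common_denominator ringA fracA q.
exists ((d * e) *: p), ((d * e) *: q); split.
- by rewrite mulrC -scalerA; exact: (coefs_inZ ringA).
- by rewrite -scalerA; exact: (coefs_inZ ringA).
- by rewrite scaler_eq0 mulf_eq0 !negb_or d0 e0.
rewrite -!mul_polyC !rmorphM; field.
by rewrite !phi_eq0 !polyC_eq0 ?q0 ?d0 ?e0.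
Qed.

(** The polynomial y inverting the content of g turns f/g into yf/(yg). *)
Lemma nagata_div f g : PvMD A -> g != 0 ->
  (forall i, op_v A (cont A g) f`_i) -> N (phi f / phi g).
Proof.
move=> pvmd g0 fg; have [y [prim_yg gy]] := PvMD_inverse ringA fracA pvmd g0.
have [yg0 _ _] := prim_yg.
have y0 : y != 0 by apply: contra_neq yg0 => ->; rewrite mul0r.
exists (y * f), (y * g); split=> //.
  move=> i; rewrite coefM; apply: (subring_sum ringA) => j _; rewrite mulrC.
  apply: (op_v_contP ringA g _).1 => // k.
  by rewrite coefZ mulrC -coefZ; exact: gy.
rewrite !rmorphM; field.
by rewrite !phi_eq0 ?g0 ?g'0 ?y0.
Qed.

Lemma nagata_coef_div g i : PvMD A -> g != 0 -> N (phi (g`_i)%:P / phi g).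
Proof.
move=> pvmd g0; apply: nagata_div => // j; rewrite coefC.
by case: ifP => _; [apply: op_v_ext; exact: mem_cont|
  exact: (submodule0 (submodule_op_v ringA _))].
Qed.

(** In the Nagata ring a polynomial divides all polynomials with coefficients in
    its content, so p + X^m q generates the ideal (p, q) when m is large. *)
Lemma nagata_bezout : PvMD A -> bezout N.
Proof.
move=> pvmd x x'.
have [f [g [Af Ag g0 ->]]] := integral_fraction x.
have [f' [g' [Af' Ag' g'0 ->]]] := integral_fraction x'.
pose p := f * g'; pose q := f' * g; pose m := size p; pose h := p + 'X^m * q.
have [ph qh _] := cont_join ringA q (leqnn m).
have gF0 : phi g != 0 by rewrite phi_eq0.
have g'F0 : phi g' != 0 by rewrite phi_eq0.
have divh r : cont A r `<=` cont A h -> exists2 c, N c & phi h * c = phi r.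
  move=> rh; have [h0|h0] := eqVneq h 0.
    exists 0; first by rewrite -(rmorph0 phi); apply/nagata_poly => i;
      rewrite coef0; exact: (subring0 ringA).
    suff -> : r = 0 by rewrite rmorph0 mulr0.
    apply/polyP => i; rewrite coef0.
    by have := rh _ (mem_cont A r i); rewrite h0 => /cont_poly0.
  exists (phi r / phi h); last by field; rewrite phi_eq0.
  apply: nagata_div => // i; apply: op_v_ext; apply: rh; exact: mem_cont.
have [c Nc hc] := divh p ph; have [c' Nc' hc'] := divh q qh.
exists (phi h / phi (g * g')); split.
- exists 1, (phi 'X^m); split; first by case: subring_nagata.
    by apply/nagata_poly; exact: (coefs_inXn ringA).
  rewrite /h /p /q rmorphD !rmorphM; field.
  by rewrite gF0 g'F0.
- exists c => //; rewrite mulrAC hc /p !rmorphM; field.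
  by rewrite gF0 g'F0.
exists c' => //; rewrite mulrAC hc' /q !rmorphM; field.
by rewrite gF0 g'F0.
Qed.

(** Every ideal J of the Nagata ring is generated by its trace I on A, because
    it contains the coefficients of the polynomials in it.  The dual of I is
    contained in the dual of J, so the constants in J^v lie in I^v. *)
Lemma nagata_divisorial : PvMD A -> eq_on_F A (op_v A) (op_t A) ->
  divisorial_domain N.
Proof.
move=> pvmd vt J [mJ JN] [j0 Jj0 j00]; have ringN := subring_nagata.
(* an N-module contains f/g exactly when it contains the coefficients of f *)
have coefJ (E : set L) f g i : submodule N E -> vprim A g -> coefs_in A f ->
    E (phi f / phi g) -> E (phi (f`_i)%:P).
  move=> mE prim_g Af Ef; have [g0 Ag _] := prim_g.
  have [f0|f0] := eqVneq f 0.
    by rewrite f0 coef0 rmorph0; exact: submodule0 mE.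
  have -> : phi (f`_i)%:P = phi g * (phi (f`_i)%:P / phi f) * (phi f / phi g).
    by field; rewrite !phi_eq0 g0.
  apply: (submoduleZ mE) => //; apply: (subringM ringN).
    exact/nagata_poly.
  exact: nagata_coef_div.
have buildJ (E : set L) f g : submodule N E -> vprim A g ->
    (forall i, E (phi (f`_i)%:P)) -> E (phi f / phi g).
  move=> mE prim_g Ef; rewrite mulrC; apply: (submoduleZ mE).
    exact: nagata_inv.
  rewrite -[f]coefK poly_def raddf_sum; apply: (submodule_sum ringN) => // i _.
  rewrite -mul_polyC mulrC /= rmorphM; apply: (submoduleZ mE) => //.
  by apply/nagata_poly; exact: (coefs_inXn ringA).
pose I := [set a | J (phi a%:P)].
have mI : submodule A I.
  split=> [|a x y Aa Ix Iy]; rewrite /I /=.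
    by rewrite rmorph0; exact: submodule0 mJ.
  rewrite polyCD polyCM rmorphD rmorphM; have [_] := mJ; apply=> //.
  exact/nagata_const.
have IA : I `<=` A by move=> a /JN /nagata_const.
have I0 : nonzero I.
  have [f [g [Af prim_g j0E]]] := JN j0 Jj0.
  have f0 : f != 0 by apply: contra_neq j00 => f0; rewrite j0E f0 rmorph0 mul0r.
  exists (lead_coef f); last by rewrite lead_coef_eq0.
  by apply: (coefJ J f g) => //; rewrite -j0E.
have fI : frac_ideal A I.
  split=> //; exists 1; split; [exact: (subring1 ringA)|exact: oner_neq0|].
  by move=> x Ix; rewrite mul1r; exact: IA.
have IvI : op_v A I `<=` I.
  move=> a; rewrite (vt I fI) -(PvMD_eq_w_t ringA fracA pvmd fI).
  move=> /(op_wP ringA fracA a mI I0) [g prim_g Ig]; have [g0 _ _] := prim_g.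
  rewrite /I /=; have -> : phi a%:P = phi (a *: g) / phi g.
    by rewrite -mul_polyC rmorphM mulfK // phi_eq0.
  exact: buildJ.
apply/seteqP; split; last exact: op_v_ext.
move=> z vz; have Nz : N z by rewrite -(op_v_ring N); apply: op_v_mono vz.
have [f [g [Af prim_g zE]]] := Nz; rewrite zE; apply: (buildJ J) => // i.
apply: IvI => y yI; apply/nagata_const.
rewrite polyCM rmorphM; apply: (coefJ (op_v N J) f g i) => //.
- exact: (submodule_op_v ringN).
- by rewrite -zE.
move=> w Jw; have [p [q [Ap prim_q wE]]] := JN w Jw.
rewrite wE mulrA -rmorphM mul_polyC; apply: (buildJ N) => //.
  exact: (submodule_self ringN).
move=> k; apply/nagata_const; rewrite coefZ; apply: yI.
by apply: (coefJ J p q) => //; rewrite -wE.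
Qed.

(** For a nonzero ideal I of A and u in the dual of IN, dividing by a nonzero
    element of I shows that u = p/g with c(g)^v = A, and then p multiplies I
    into N and K[X], hence into A[X].  So I^v is contained in (IN)^v = IN,
    whose constants form I^w. *)
Lemma nagata_divisorial_v_sub_w I : divisorial_domain N ->
  ideal A I -> nonzero I -> op_v A I `<=` op_w A I.
Proof.
move=> divN [mI IA] I0 x vx; have [i0 Ii0 i00] := I0.
have ringN := subring_nagata.
pose J : set L := [set z | exists f g, [/\ coefs_in I f, vprim A g & z = phi f / phi g]].
have JP i : I i -> J (phi i%:P).
  move=> Ii; exists (i%:P), 1; split;
    [|exact: (vprim1 ringA)|by rewrite rmorph1 divr1].
  by move=> k; rewrite coefC; case: ifP => // _; exact: submodule0 mI.
have idJ : ideal N J.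
  split=> [|_ [f [g [If prim_g ->]]]]; last first.
    by exists f, g; split=> // i; exact: IA.
  split; first by rewrite -(rmorph0 phi) -polyC0; apply: JP;
    exact: submodule0 mI.
  move=> _ _ _ [a [b [Aa prim_b ->]]] [f [g [If prim_g ->]]] [f' [g' [If' prim_g' ->]]].
  have [b0 Ab _] := prim_b; have [g0 Ag _] := prim_g; have [g'0 Ag' _] :=
    prim_g'.
  exists (a * g' * f + b * g * f'), (b * g * g'); split.
  - move=> i; rewrite coefD; apply: (submoduleD ringA mI).
      by apply: (submodule_coefs_inM ringA mI) => //; exact: (coefs_inM ringA).
    by apply: (submodule_coefs_inM ringA mI) => //; exact: (coefs_inM ringA).
  - by do 2?apply: (vprimM ringA).
  rewrite rmorphD !rmorphM; field.
  by rewrite !phi_eq0 b0 g0 g'0.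
have J0 : nonzero J.
  by exists (phi i0%:P); [exact: JP|rewrite phi_eq0 polyC_eq0].
have : op_v N J (phi x%:P).
  move=> u uJ; have [f [g [Af prim_g uE]]] := uJ _ (JP i0 Ii0).
  have [g0 Ag _] := prim_g; pose p := i0^-1 *: f.
  have {}uE : u = phi p / phi g.
    apply: (@mulIf _ (phi i0%:P)); first by rewrite phi_eq0 polyC_eq0.
    rewrite uE /p mulrAC -rmorphM [_ * i0%:P]mulrC mul_polyC scalerA mulfV //.
    by rewrite scale1r.
  have Ip k : colon A I p`_k.
    move=> i Ii; have : N (phi (i *: p)).
      have -> : phi (i *: p) = u * phi i%:P * phi g.
        by rewrite uE -mul_polyC rmorphM; field; rewrite phi_eq0.
      by apply: (subringM ringN); [exact/uJ/JP|exact/nagata_poly].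
    by move=> /nagata_poly /(_ k); rewrite coefZ mulrC.
  exists (x *: p), g; split=> //.
    by move=> k; rewrite coefZ; exact: vx.
  by rewrite uE -mul_polyC rmorphM mulrA.
rewrite divN // => -[f [g [If prim_g xE]]].
apply/(op_wP ringA fracA) => //; exists g => //; have [g0 _ _] := prim_g.
suff -> : x *: g = f by [].
by apply/eqP; rewrite -(inj_eq phi_inj) -mul_polyC rmorphM xE divfK // phi_eq0.
Qed.

Lemma nagata_divisorial_eq_v_w :
  divisorial_domain N -> eq_on_F A (op_v A) (op_w A).
Proof.
move=> divN E fE; apply/seteqP; split; last first.
  by move=> x /(op_w_sub_t ringA fracA fE); exact: op_t_sub_v.
have [mE [e Ee e0] [d [Ad d0 dE]]] := fE.
have E0 : nonzero E by exists e.
move=> x vx; pose I := [set z | E (z / d)].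
have mI : submodule A I.
  have -> : I = [set z | E (d^-1 * z)] by apply/funext => z;
    rewrite /I /= mulrC.
  exact: (submodule_preim ringA).
have IA : I `<=` A by move=> z /dE; rewrite mulrC divfK.
have I0 : nonzero I by exists (e * d); [rewrite /I /= mulfK|rewrite mulf_neq0].
have : op_w A I (x * d).
  apply: (nagata_divisorial_v_sub_w divN) => //.
  move=> u uI; rewrite -mulrA; apply: vx => z Ez.
  have -> : d * u * z = u * (z * d) by ring.
  by apply: uI; rewrite /I /= mulfK.
move=> /(op_wP ringA fracA _ mI I0) [g prim_g Ig].
apply/(op_wP ringA fracA) => //; exists g => // i.
by have := Ig i; rewrite /I /= !coefZ mulrAC mulfK.
Qed.

(** * The Kronecker function ring *)

Lemma PvMD_nagata_kronecker : PvMD A -> N = kronecker.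
Proof.
move=> pvmd; have vA := PvMD_v_domain ringA pvmd.
apply/seteqP; split=> [z [f [g [Af prim_g ->]]]|z [f [g [Af Ag g0 [h [h0 Ah fgh]] ->]]]].
  have [g0 Ag _] := prim_g; exists f, g; split=> //.
  exists 1; split; [exact: oner_neq0|exact: (coefs_in1 ringA)|].
  rewrite (cont1 ringA) ![mprod A _ A]mprodC !(mprod_ringl ringA);
    try exact: submodule_cont.
  have /(vprimP ringA) -> := prim_g => //.
  exact: (cont_sub (submodule_self ringA) Af).
apply: nagata_div => // i;
  apply: (v_domain_cancel ringA vA (fg_frac_ideal_cont ringA fracA h0)).
by move=> c hc; apply: fgh; apply: mem_mprod => //; exact: mem_cont.
Qed.

(** For a coefficient a of g, the fraction a/g lies in the Kronecker function
    ring.  If it equals the Nagata ring, these fractions have a common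
    denominator whose content has trivial dual.  This denominator is yg for
    some y, and the coefficients of y belong to the dual of c(g). *)
Lemma kronecker_PvMD : N = kronecker -> PvMD A.
Proof.
move=> NKr; apply/(inverse_PvMD ringA fracA) => g' g'0.
have [d [Ad d0 Ag]] := common_denominator ringA fracA g'.
set g := d *: g' in Ag.
have g0 : g != 0 by rewrite scaler_eq0 negb_or d0.
have Ng i : N (phi (g`_i)%:P / phi g).
  rewrite NKr; exists (g`_i)%:P, g; split=> //; first exact: (coefs_inC ringA).
  exists 1; split; [exact: oner_neq0|exact: (coefs_in1 ringA)|].
  rewrite (cont1 ringA) ![mprod A _ A]mprodC !(mprod_ringl ringA);
    try exact: submodule_cont.
  apply: cont_sub; first exact: (submodule_op_v ringA).
  move=> k; apply: op_v_ext; rewrite coefC; case: ifP => _;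
    first exact: mem_cont.
  exact: (submodule0 (submodule_cont A g)).
have [c prim_c cg] : exists2 c, vprim A c & forall i, (i < size g)%N ->
    exists2 q, coefs_in A q & g`_i *: c = q * g.
  elim: (size g) => [|n [c prim_c cg]]; first by exists 1 => //;
    exact: (vprim1 ringA).
  have [q [e [Aq prim_e qe]]] := Ng n; have [e0 Ae _] := prim_e.
  have [_ Ac _] := prim_c.
  have eg : g`_n *: e = q * g.
    apply: phi_inj; rewrite -mul_polyC !rmorphM.
    have <- : phi e * (phi q / phi e) = phi q by field; rewrite phi_eq0.
    by rewrite -qe; field; rewrite phi_eq0.
  exists (c * e); first exact: (vprimM ringA).
  move=> i; rewrite ltnS leq_eqVlt => /predU1P[->|/cg [p Ap cp]].
    by exists (c * q); [exact: (coefs_inM ringA)|rewrite scalerAr eg mulrA].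
  by exists (e * p); [exact: (coefs_inM ringA)|rewrite scalerAl cp mulrC mulrA].
have [c0 Ac primc] := prim_c.
have lt_top : ((size g).-1 < size g)%N by rewrite prednK // size_poly_gt0.
have [q Aq cq] := cg _ lt_top; rewrite -/(lead_coef g) in cq.
set a := lead_coef g in cq; have a0 : a != 0 by rewrite lead_coef_eq0.
pose y := (d / a) *: q; exists y.
have yg' : y * g' = c.
  have -> : g' = d^-1 *: g by rewrite scalerA mulVf // scale1r.
  rewrite /y -scalerAl -scalerAr scalerA -cq scalerA.
  suff -> : d / a / d * a = 1 by rewrite scale1r.
  by field; rewrite a0 d0.
split; first by rewrite yg'.
move=> i; have -> : g'`_i *: y = (g`_i / a) *: q.
  rewrite /y scalerA /g coefZ; congr (_ *: _); ring.
have [lti|lei] := ltnP i (size g); last first.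
  rewrite [g`_i]nth_default // mul0r scale0r => k.
  by rewrite coef0; exact: (subring0 ringA).
have [p Ap cp] := cg i lti.
suff -> : (g`_i / a) *: q = p by [].
apply: (mulIf g0); rewrite -cp -scalerAl -cq scalerA divfK //.
Qed.

End FunctionRings.

(** * The domain inside its quotient field *)

Section Domain.
Variable D : idomainType.
Local Notation K := {fraction D}.
Local Notation A := (dom D).
Local Notation phi := (@tofrac {poly K}).

Lemma tofrac_inj (R : idomainType) : injective (@tofrac R).
Proof. by move=> x y /eqP; rewrite tofrac_eq => /eqP. Qed.

Lemma subring_dom : subring A.
Proof.
split; first by exists 1; rewrite ?tofrac1.
  by move=> _ _ [x _ <-] [y _ <-]; exists (x - y); rewrite ?tofracB.
by move=> _ _ [x _ <-] [y _ <-]; exists (x * y); rewrite ?tofracM.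
Qed.

Lemma quotient_field_dom : quotient_field A.
Proof.
move=> x; have [a [b [b0 ->]]] := fractionP x.
by exists (tofrac a), (tofrac b); split;
  [exists a|exists b|rewrite tofrac_eq0|].
Qed.

Lemma coefs_in_domP (p : {poly K}) :
  coefs_in A p <-> exists f : {poly D}, p = map_poly (@tofrac D) f.
Proof.
split=> [Ap|[f ->] i]; last by rewrite coef_map; exists f`_i.
have [c cP] : exists c : nat -> D, forall i, tofrac (c i) = p`_i.
  have /choice [c cP] : forall i, exists a : D, tofrac a = p`_i.
    by move=> i; have [a _ ap] := Ap i; exists a.
  by exists c.
exists (\poly_(i < size p) c i); apply/polyP => i;
  rewrite coef_map coef_poly /=.
by case: ltnP => [_|lei]; [rewrite cP|rewrite nth_default ?tofrac0].
Qed.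

Lemma content_cont (h : {poly D}) :
  content h = cont A (map_poly (@tofrac D) h).
Proof.
rewrite map_polyE -cont_Poly; congr (span _ _); apply/seteqP; split=> x /=.
  by move=> [c hc <-]; exact: map_f.
by move=> /mapP [c hc ->]; exists c.
Qed.

Lemma map_tofrac_eq0 (h : {poly D}) : (map_poly (@tofrac D) h == 0) = (h == 0).
Proof.
rewrite -(inj_eq (map_inj_poly (@tofrac_inj D) (tofrac0 D))) rmorph0.
by [].
Qed.

Lemma Na_vE : Na_v D = nagata A phi.
Proof.
apply/seteqP; split=> z.
  move=> [f [g [g0 cg ->]]];
    exists (map_poly (@tofrac D) f), (map_poly (@tofrac D) g).
  split=> //; first by apply/coefs_in_domP; exists f.
  apply/(vprimP subring_dom); first by rewrite map_tofrac_eq0.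
    by apply/coefs_in_domP; exists g.
  by rewrite -content_cont.
move=> [p [q [Ap prim_q ->]]]; have [q0 Aq _] := prim_q.
have /coefs_in_domP [f pE] := Ap; have /coefs_in_domP [g qE] := Aq.
exists f, g; split; first by rewrite -map_tofrac_eq0 -qE.
  by rewrite content_cont -qE; have /(vprimP subring_dom) -> := prim_q.
by rewrite /polyfrac -pE -qE.
Qed.

Lemma Kr_vE : Kr_v D = kronecker A phi.
Proof.
apply/seteqP; split=> z.
  move=> [f [g [g0 [h h0 fgh] ->]]].
  exists (map_poly (@tofrac D) f), (map_poly (@tofrac D) g); split=> //.
  - by apply/coefs_in_domP; exists f.
  - by apply/coefs_in_domP; exists g.
  - by rewrite map_tofrac_eq0.
  exists (map_poly (@tofrac D) h); split; first by rewrite map_tofrac_eq0.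
    by apply/coefs_in_domP; exists h.
  by rewrite -!content_cont.
move=> [p [q [/coefs_in_domP [f ->] /coefs_in_domP [g ->] g0 [r [r0 Ar fgr]] ->]]].
have /coefs_in_domP [h rE] := Ar.
exists f, g; split=> //; first by rewrite -map_tofrac_eq0.
exists h; first by rewrite -map_tofrac_eq0 -rE.
by rewrite !content_cont -rE.
Qed.

(** * Integral closure *)

Lemma cont_lin_comb g (z : K) : cont A g z ->
  exists c : nat -> D, z = \sum_(i < size g) tofrac (c i) * g`_i.
Proof.
have ringA := subring_dom.
rewrite -[X in _ -> X]/([set z | exists c : nat -> D,
  z = \sum_(i < size g) tofrac (c i) * g`_i] z).
move: z; apply: cont_sub => [|i /=].
  split=> [|_ _ _ [a _ <-] [c ->] [c' ->]].
    exists (fun=> 0); rewrite big1 // => i _; by rewrite tofrac0 mul0r.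
  exists (fun i => a * c i + c' i); rewrite mulr_sumr -big_split /=.
  by apply: eq_bigr => i _; rewrite tofracD tofracM mulrDl mulrA.
have [lti|lei] := ltnP i (size g); last first.
  exists (fun=> 0); rewrite nth_default // big1 // => j _.
  by rewrite tofrac0 mul0r.
exists (fun j => (j == i)%:R); rewrite (bigD1 (Ordinal lti)) //= eqxx.
rewrite tofrac1 mul1r big1 ?addr0 // => j neqj.
have -> : (j == i :> nat) = false by apply/negbTE; apply: contra neqj.
by rewrite tofrac0 mul0r.
Qed.

(** If xF is contained in F, then x is an eigenvalue of a matrix over the
    domain, with the generators of F as eigenvector.  Conversely, the powers of
    an integral element x span an F with xF contained in F. *)
Lemma integrally_closedP : integrally_closed D <->
  forall F, fg_frac_ideal A F -> colon F F `<=` A.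
Proof.
have ringA := subring_dom; have fracA := quotient_field_dom.
split=> [closedD F fgF x xF|closedA x [p monp rootp]].
  have [g g0 defF] := (fg_frac_idealP ringA fracA F).1 fgF.
  have /choice [c cE] : forall i, exists c : nat -> D,
      x * g`_i = \sum_(j < size g) tofrac (c j) * g`_j.
    move=> i; apply: cont_lin_comb; rewrite -defF; apply: xF.
    by rewrite defF; exact: mem_cont.
  pose M : 'M[D]_(size g) := \matrix_(j, i) c i j.
  apply: closedD; exists (char_poly M); first exact: char_poly_monic.
  rewrite map_char_poly -eigenvalue_root_char.
  apply/eigenvalueP; exists (\row_j g`_j).
    apply/rowP => i; rewrite !mxE cE; apply: eq_bigr => j _.
    by rewrite !mxE mulrC.
  apply: contraNneq g0 => /rowP row0; apply/eqP/polyP => i; rewrite coef0.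
  have [lti|lei] := ltnP i (size g); last by rewrite nth_default.
  by have := row0 (Ordinal lti); rewrite !mxE.
pose n := (size p).-1.
have szp : size p = n.+1 by rewrite prednK // size_poly_gt0 monic_neq0.
have n_gt0 : (0 < n)%N.
  rewrite lt0n; apply: contraL rootp => /eqP n0.
  have -> : p = 1.
    move: monp; have /size_poly1P [c c0 ->] : size p == 1%N by rewrite szp n0.
    by rewrite monicE lead_coefC => /eqP ->.
  by rewrite rmorph1 rootC oner_eq0.
pose g : {poly K} := \poly_(i < n) x ^+ i.
have g0 : g != 0.
  apply/eqP => /polyP /(_ 0%N); rewrite coef_poly n_gt0 coef0 expr0.
  by move/eqP; rewrite oner_eq0.
apply: (closedA _ (fg_frac_ideal_cont ringA fracA g0)).
have mg := submodule_cont A g.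
have gx i : (i < n)%N -> cont A g (x ^+ i).
  by move=> lti; have := mem_cont A g i; rewrite coef_poly lti.
apply/(colon_contP ringA _ _ mg) => i; rewrite coef_poly.
case: ltnP => lti; last by rewrite mulr0; exact: submodule0 mg.
rewrite -exprS; have [/gx//|] := ltnP i.+1 n.
rewrite leq_eqVlt ltnS leqNgt lti orbF => /eqP <-.
have -> : x ^+ n = - \sum_(j < n) tofrac p`_j * x ^+ j.
  move: rootp; rewrite /root horner_coef size_map_inj_poly; last 2 first.
  - exact: tofrac_inj.
  - exact: tofrac0.
  rewrite szp big_ord_recr /= coef_map /=.
  have -> : p`_n = 1 by move: monp; rewrite monicE /lead_coef => /eqP.
  rewrite tofrac1 mul1r addrC addr_eq0 => /eqP ->; congr (- _).
  by apply: eq_bigr => j _; rewrite coef_map.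
apply: (submoduleN ringA mg); apply: (submodule_sum ringA) => // j _.
by apply: (submoduleZ mg); [exists p`_j|exact: gx].
Qed.

Lemma v_domain_integrally_closed : v_domain A -> integrally_closed D.
Proof.
move=> /(v_domainP subring_dom) vA; apply/integrally_closedP => F fgF x xF.
by apply: (vA F fgF) => y Fy; apply: op_v_ext; exact: xF.
Qed.

Lemma eq_v_w_v_domain : integrally_closed D ->
  eq_on_F A (op_v A) (op_w A) -> v_domain A.
Proof.
have ringA := subring_dom; have fracA := quotient_field_dom.
move=> /integrally_closedP closedA vw; apply/(v_domainP ringA) => F fgF.
by rewrite vw; [exact: colon_op_w_sub|case: fgF].
Qed.

End Domain.

(** * The equivalences *)

Theorem proposition29 (D : idomainType) :
  let A := dom D in
  let v := op_v A in
  let t := op_t A in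
  let w := op_w A in
  let v_a := op_a A v in
  let t_a := op_a A t in
  let w_a := op_a A w in
  [<-> (* i *) eq_on_F A v v_a;
       (* ii *) PvMD A /\ eq_on_F A v t;
       (* iii *) v_domain A /\ eq_on_F A v t;
       (* iv *) essential_domain A /\ eq_on_F A v t;
       (* v *) integrally_closed D /\ divisorial_domain (Na_v D);
       (* vi *) integrally_closed D /\ eq_on_F A v w;
       (* vii *) [/\ Na_v D = Kr_v D, h_local (Na_v D) &
                     forall M, maximal_ideal (Na_v D) M -> fin_gen (Na_v D) M];
       (* viii *) eq_on_F A w v_a /\ eq_on_F A v t;
       (* ix *) eq_on_F A v w_a;
       (* x *) [/\ eq_on_F A w t, eq_on_F A t v, eq_on_F A v w_a,
                   eq_on_F A w_a t_a & eq_on_F A t_a v_a]].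
Proof.
move=> A v t w v_a t_a w_a.
have ringA : subring A := subring_dom D.
have fracA : quotient_field A := quotient_field_dom (D := D).
have phi_inj := @tofrac_inj {poly {fraction D}}.
have phi_frac := @fractionP {poly {fraction D}}.
have ringN : subring (Na_v D) by rewrite Na_vE; exact: subring_nagata.
have bezN : PvMD A -> bezout (Na_v D).
  by rewrite Na_vE => pvmd; exact: nagata_bezout.
have vt_of_vw : eq_on_F A v w -> eq_on_F A v t.
  move=> vw E fE; apply/seteqP; split; last exact: op_t_sub_v.
  by rewrite vw //; exact: op_w_sub_t.
have pvmd_of_v : v_domain A -> eq_on_F A v t -> PvMD A.
  move=> vA vt F fgF; rewrite -[RHS](vA F fgF); symmetry; apply: vt.
  have [[_ [f Ff f0] [d [Ad d0 dF]]] _] := fgF.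
  split; first exact: submodule_span.
    exists (f * d); last by rewrite mulf_neq0.
    exact: mem_mprod.
  exists 1; split; [exact: (subring1 ringA)|exact: oner_neq0|].
  by move=> x /(mprod_self_sub_colon ringA); rewrite mul1r.
have divN : PvMD A -> eq_on_F A v t -> divisorial_domain (Na_v D).
  by rewrite Na_vE; exact: nagata_divisorial.
have vw_of_divN : divisorial_domain (Na_v D) -> eq_on_F A v w.
  by rewrite Na_vE; exact: nagata_divisorial_eq_v_w.
have iii_of_vi : integrally_closed D -> eq_on_F A v w ->
    v_domain A /\ eq_on_F A v t.
  by move=> clD vw; split; [exact: eq_v_w_v_domain|exact: vt_of_vw].
have x_of_ii : PvMD A -> eq_on_F A v t -> [/\ eq_on_F A w t, eq_on_F A t v,
    eq_on_F A v w_a, eq_on_F A w_a t_a & eq_on_F A t_a v_a].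
  move=> pvmd vt; have wt : eq_on_F A w t := PvMD_eq_w_t ringA fracA pvmd.
  have tv : eq_on_F A t v by move=> E fE; rewrite vt.
  have vva := v_domain_eq_op_a_v ringA fracA (PvMD_v_domain ringA pvmd) vt.
  have ta_va E : t_a E = v_a E by exact: op_a_eq_on.
  have wa_ta E : w_a E = t_a E by exact: op_a_eq_on.
  split=> // E fE.
  by rewrite wa_ta ta_va; exact: vva.
tfae.
- move=> vva; split; last exact: (eq_v_t_of_op_a vva).
  apply: pvmd_of_v; last exact: (eq_v_t_of_op_a vva).
  exact: v_domain_of_op_a_v.
- by move=> [pvmd vt]; split=> //; exact: PvMD_v_domain.
- move=> [vA vt]; split=> //; apply: PvMD_essential => //; exact: pvmd_of_v.
- move=> [essA vt]; have vA := essential_v_domain ringA fracA essA.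
  by split; [exact: v_domain_integrally_closed|apply: divN => //;
    exact: pvmd_of_v].
- by move=> [clD dN]; split=> //; exact: vw_of_divN.
- move=> [clD vw]; have [vA vt] := iii_of_vi clD vw.
  have pvmd := pvmd_of_v vA vt; have dN := divN pvmd vt; have bN := bezN pvmd.
  split.
  + by rewrite Na_vE Kr_vE; exact: PvMD_nagata_kronecker.
  + exact: divisorial_h_local.
  move=> M maxM; have [a ->] := divisorial_maximal_principal ringN bN dN maxM.
  exact: fin_gen_of_principal.
- move=> [NKr hlocN fgN].
  have pvmd : PvMD A.
    by apply: (kronecker_PvMD ringA fracA phi_inj); rewrite -Na_vE -Kr_vE.
  have bN := bezN pvmd.
  have dN : divisorial_domain (Na_v D).
    apply: (h_local_divisorial ringN bN hlocN) => M maxM.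
    by apply: (fin_gen_principal ringN bN); exact: fgN.
  have vt := vt_of_vw (vw_of_divN dN).
  have [wt tv vwa wta tva] := x_of_ii pvmd vt.
  split=> // E fE; rewrite wt // tv // vwa // wta //; exact: tva.
- move=> [wva vt].
  have vva : eq_on_F A v v_a.
    move=> E fE; apply/seteqP; split; first by rewrite vt //;
      exact: op_t_sub_op_a_v.
    by rewrite -wva // vt //; exact: op_w_sub_t.
  have vA := v_domain_of_op_a_v ringA fracA vva.
  by have [] := x_of_ii (pvmd_of_v vA vt) vt.
- move=> vwa; have vt := eq_v_t_of_op_a vwa.
  have vA := v_domain_of_op_a_w ringA fracA vwa.
  by apply: x_of_ii => //; exact: pvmd_of_v.
move=> [wt tv vwa wta tva] E fE.
by rewrite vwa // wta //; exact: tva.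
Qed.
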